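(* Let $\Gamma \subseteq Form^{Ag}$ and let $\mathcal{CS}$ be a constant specification. Then $\Gamma$ is $\mathcal{CS}$-consistent iff $\Gamma$ is satisfiable in a $\mathcal{CS}$-normal jstit model iff $\Gamma$ is satisfiable in a unirelational $\mathcal{CS}$-normal jstit model.
   Context: Setting. $Ag$ is a fixed finite set of agents. Proof polynomials: $t := x \mid c \mid s+t \mid s\times t \mid\ !t$ ($x$ proof variables, $c$ proof constants). Formulas $Form^{Ag}$: $A := p \mid A\wedge B \mid \neg A \mid [j]A \mid \Box A \mid t:A \mid KA \mid Prove(j,t,A) \mid Proven(t,A)$, with $p$ a propositional variable, $j\in Ag$; $\Diamond$, $\langle j\rangle$ are the duals of $\Box$, $[j]$. A jstit model is $\mathcal{M}=\langle Tree,\unlhd,Choice,Act,R,R_e,\mathcal{E},V\rangle$: $\unlhd$ a partial order on moments $Tree$; histories are maximal $\unlhd$-chains, $H_m$ the histories through $m$; $Choice^m_j$ a partition of $H_m$; $Act$ maps moment–history pairs to sets of polynomials; $R\subseteq R_e$ preorders on $Tree$; $\mathcal{E}(m,t)$ a set of formulas; $V$ a valuation. With $Act_m=\bigcap_{h\in H_m}Act(m,h)$, $Act_{(m,h,j)}=\bigcap_{g\in Choice^m_j(h)}Act(m,g)$, and $h\approx_m g$ iff $h,g\in H_{m'}$ for some $m'\rhd m$, the constraints are: historical connection; no backward branching; no choice between undivided histories; independence of agents; $R_e(m,m')\Rightarrow \mathcal{E}(m,t)\subseteq\mathcal{E}(m',t)$; evidence closure under $\times$ (application of implication), $+$ (union)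 and $!$ ($A\in\mathcal{E}(m,t)\Rightarrow t:A\in\mathcal{E}(m,!t)$); $m'\lhd m,\ h\in H_m\Rightarrow Act(m',h)\subseteq Act(m,h)$; $Act_m\subseteq\bigcup_{m'\lhd m,h\in H_m}Act(m',h)$; $h\approx_m h'\Rightarrow Act(m,h)=Act(m,h')$; $\unlhd\subseteq R$; $R_e(m,m')\Rightarrow Act_m\subseteq Act_{m'}$. Satisfaction at $(m,h)$ is standard for $p$, Booleans, $[j]$ (over $Choice^m_j(h)$), $\Box$ (over $H_m$), $K$ (over all $(m',h')$ with $R(m,m')$); $t:A$ holds iff $A\in\mathcal{E}(m,t)$ and $A$ holds at all $(m',h')$ with $R_e(m,m')$; $Prove(j,t,A)$ iff $t\in Act_{(m,h,j)}$, $t:A$ holds, and $t\notin Act_m$; $Proven(t,A)$ iff $t\in Act_m$ and $t:A$ holds. A model is unirelational if $R_e\subseteq R$ (so $R=R_e$). The axiom system $\Pi$ has: (A0) classical propositional tautologies; (A1) S5 for $\Box$ and each $[j]$; (A2) $\Box A\to[j]A$; (A3) $(\Diamond[j_1]A_1\wedge\dots\wedge\Diamond[j_n]A_n)\to\Diamond([j_1]A_1\wedge\dots\wedge[j_n]A_n)$ for pairwise distinct $j_i$; (A4) $s:(A\to B)\to(t:A\to(s\times t):B)$; (A5) $t:A\to(!t:(t:A)\wedge KA)$; (A6) $(s:A\vee t:A)\to(s+t):A$; (A7) S4 for $K$; (A8) $KA\to\Box K\Box A$; (B9) $Prove(j,t,A)\to(\neg Proven(t,A)\wedge[j]Prove(j,t,A)\wedge\neg\Box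 Prove(j,t,A)\wedge t:A)$; (B10) $(Prove(j,t,A)\wedge t:B)\to Prove(j,t,B)$; (B11) $Proven(t,A)\to(KProven(t,A)\wedge t:A)$; (B12) $(Proven(t,A)\wedge t:B)\to Proven(t,B)$; (B13) $\neg Prove(j,t,A)\to\langle j\rangle\bigwedge_{i\in Ag}\neg Prove(i,t,A)$. Rules: modus ponens; from $A$ infer $KA$; (S4) from $KA\to(\neg Proven(t_1,B_1)\vee\dots\vee\neg Proven(t_n,B_n))$ infer $KA\to(\bigwedge_{j\in Ag}\neg Prove(j,t_1,B_1)\vee\dots\vee\bigwedge_{j\in Ag}\neg Prove(j,t_n,B_n))$. A constant specification $\mathcal{CS}$ is a set of formulas $c_n:\dots c_1:A$ ($c_i$ constants, $A$ an axiom instance) closed under removing the outermost constant; $\Pi(\mathcal{CS})$ adds the rule inferring any member of $\mathcal{CS}$. $\Gamma$ is $\mathcal{CS}$-consistent iff there are no $A_1,\dots,A_n\in\Gamma$ with $\Pi(\mathcal{CS})\vdash(A_1\wedge\dots\wedge A_n)\to\bot$. A jstit model is $\mathcal{CS}$-normal iff $\{A\mid c:A\in\mathcal{CS}\}\subseteq\mathcal{E}(m,c)$ for all constants $c$ and moments $m$. *)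

(* Defs.v *)
From Stdlib Require Relation_Definitions List.
From mathcomp Require Import all_boot.
From mathcomp Require Import boolp classical_sets.

Set Implicit Arguments.
Unset Strict Implicit.
Unset Printing Implicit Defensive.

Local Open Scope classical_set_scope.

(* Propositional variables, proof variables and proof constants each form a
   countably infinite alphabet, represented by [nat]. *)

Inductive poly : Type :=
| PVar of nat
| PConst of nat
| PSum of poly & poly
| PProd of poly & poly
| PBang of poly.

Inductive form (Ag : Type) : Type :=
| Var of nat
| And of form Ag & form Ag
| Neg of form Ag
| Stit of Ag & form Ag
| Box of form Ag
| Just of poly & form Ag
| Know of form Ag
| Prove of Ag & poly & form Ag
| Proven of poly & form Ag.

Arguments Var {Ag} _.

Declare Scope form_scope.
Delimit Scope form_scope with form.
Bind Scope form_scope with form.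

Section Abbreviations.
Variable Ag : Type.
Implicit Types A B : form Ag.

Definition Or A B : form Ag := Neg (And (Neg A) (Neg B)).
Definition Imp A B : form Ag := Neg (And A (Neg B)).
Definition Bot : form Ag := And (Var 0) (Neg (Var 0)).
Definition Top : form Ag := Neg Bot.
Definition Dia A : form Ag := Neg (Box (Neg A)).
Definition DStit (j : Ag) A : form Ag := Neg (Stit j (Neg A)).

Fixpoint bigAnd (s : seq (form Ag)) : form Ag :=
  match s with
  | [::] => Top
  | [:: A] => A
  | A :: s' => And A (bigAnd s')
  end.

Fixpoint bigOr (s : seq (form Ag)) : form Ag :=
  match s with
  | [::] => Bot
  | [:: A] => A
  | A :: s' => Or A (bigOr s')
  end.

End Abbreviations.

Arguments Bot {Ag}.
Arguments Top {Ag}.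

Notation "~~~ A" := (Neg A) (at level 75, right associativity) : form_scope.
Notation "A &&& B" := (And A B)
  (at level 80, right associativity) : form_scope.
Notation "A ||| B" := (Or A B)
  (at level 85, right associativity) : form_scope.
Notation "A =>> B" := (Imp A B)
  (at level 90, right associativity) : form_scope.
Notation "t ::: A" := (Just t A)
  (at level 70, right associativity) : form_scope.

Section Models.
Variable Ag : finType.

(* A history is a set of moments.  [Act] and [Val] are total functions of a
   moment [m] and a set [h]; only their values at pairs where [h] is a history
   through [m] are ever constrained or used. *)
Record jstit_structure : Type := JstitStructure {
  moment : Type;
  le_mom : moment -> moment -> Prop;
  Choice : moment -> Ag -> set (set (set moment));
  Act : moment -> set moment -> set poly;
  R : moment -> moment -> Prop;
  Re : moment -> moment -> Prop;
  Evid : moment -> poly -> set (form Ag);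
  Val : nat -> moment -> set moment -> Prop
}.

Section Structure.
Variable M : jstit_structure.
Implicit Types (m : moment M) (h g : set (moment M)) (j : Ag).

Definition lt_mom m m' : Prop := le_mom m m' /\ m <> m'.

Definition history h : Prop :=
  total_on h (@le_mom M) /\
  forall h', total_on h' (@le_mom M) -> h `<=` h' -> h' = h.

(* H_m *)
Definition Hist m : set (set (moment M)) := [set h | history h /\ h m].

Definition undivided m h g : Prop :=
  exists m', lt_mom m m' /\ Hist m' h /\ Hist m' g.

(* Choice^m_j(h): since [Choice m j] is a partition of H_m, this union is the
   single cell to which [h] belongs. *)
Definition cell m j h : set (set (moment M)) :=
  \bigcup_(C in [set C | Choice m j C /\ C h]) C.

Definition Act_moment m : set poly := \bigcap_(h in Hist m) Act m h.

Definition Act_cell m h j : set poly := \bigcap_(g in cell m j h) Act m g.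

Record is_jstit_model : Prop := IsJstitModel {
  le_mom_order : Relation_Definitions.order _ (@le_mom M);
  R_preorder : Relation_Definitions.preorder _ (@R M);
  Re_preorder : Relation_Definitions.preorder _ (@Re M);
  R_sub_Re : forall m m', R m m' -> Re m m';
  Choice_partition : forall m j, partition (Choice m j) id (Hist m);
  historical_connection :
    forall m m', exists m0, le_mom m0 m /\ le_mom m0 m';
  no_backward_branching : forall m m1 m2,
    le_mom m1 m -> le_mom m2 m -> le_mom m1 m2 \/ le_mom m2 m1;
  no_choice_between_undivided : forall m j h h',
    undivided m h h' -> cell m j h = cell m j h';
  independence_of_agents : forall m (f : Ag -> set (set (moment M))),
    (forall j, Choice m j (f j)) -> \bigcap_j f j !=set0;
  evidence_monotone : forall m m' t, Re m m' -> Evid m t `<=` Evid m' t;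
  evidence_prod : forall m s t (A B : form Ag),
    Evid m s (A =>> B)%form -> Evid m t A -> Evid m (PProd s t) B;
  evidence_sum : forall m s t, Evid m s `|` Evid m t `<=` Evid m (PSum s t);
  evidence_bang : forall m t (A : form Ag),
    Evid m t A -> Evid m (PBang t) (t ::: A)%form;
  expansion_of_presented_proofs : forall m m' h,
    lt_mom m' m -> Hist m h -> Act m' h `<=` Act m h;
  no_new_proofs_guaranteed : forall m,
    Act_moment m `<=`
      [set t | exists m' h, [/\ lt_mom m' m, Hist m h & Act m' h t]];
  new_proofs_divide_histories : forall m h h',
    undivided m h h' -> Act m h = Act m h';
  future_always_matters : forall m m', le_mom m m' -> R m m';
  presented_proofs_transparent : forall m m',
    Re m m' -> Act_moment m `<=` Act_moment m'
}.

Fixpoint sat m h (A : form Ag) : Prop :=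
  match A with
  | Var p => Val p m h
  | And B C => sat m h B /\ sat m h C
  | Neg B => ~ sat m h B
  | Stit j B => forall g, cell m j h g -> sat m g B
  | Box B => forall g, Hist m g -> sat m g B
  | Know B => forall m' h', R m m' -> Hist m' h' -> sat m' h' B
  | Just t B =>
      Evid m t B /\ forall m' h', Re m m' -> Hist m' h' -> sat m' h' B
  | Prove j t B =>
      [/\ Act_cell m h j t,
          Evid m t B /\ (forall m' h', Re m m' -> Hist m' h' -> sat m' h' B)
        & ~ Act_moment m t]
  | Proven t B =>
      Act_moment m t /\
      (Evid m t B /\ forall m' h', Re m m' -> Hist m' h' -> sat m' h' B)
  end.

Definition unirelational : Prop := forall m m', Re m m' -> R m m'.

Definition normal (CS : set (form Ag)) : Prop :=
  forall (c : nat) m,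
    [set A | CS (PConst c ::: A)%form] `<=` Evid m (PConst c).

Definition satisfiable_in (Gamma : set (form Ag)) : Prop :=
  exists m h, Hist m h /\ forall A, Gamma A -> sat m h A.

End Structure.
End Models.

Section ProofTheory.
Variable Ag : finType.
Implicit Types (A B : form Ag) (s t : poly) (j : Ag).
Local Open Scope form_scope.

Fixpoint beval (v : form Ag -> bool) A : bool :=
  match A with
  | And B C => beval v B && beval v C
  | Neg B => ~~ beval v B
  | _ => v A
  end.

(* Substitution instance of a classical propositional tautology: the maximal
   subformulas not headed by [And] or [Neg] are treated as atoms. *)
Definition tautology A : Prop := forall v, beval v A.

Inductive S4_axiom (box : form Ag -> form Ag) : form Ag -> Prop :=
| S4_K A B : S4_axiom box (box (A =>> B) =>> box A =>> box B)
| S4_T A : S4_axiom box (box A =>> A)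
| S4_4 A : S4_axiom box (box A =>> box (box A)).

Inductive S5_axiom (box : form Ag -> form Ag) : form Ag -> Prop :=
| S5_S4 A : S4_axiom box A -> S5_axiom box A
| S5_5 A : S5_axiom box (~~~ box A =>> box (~~~ box A)).

Inductive is_axiom : form Ag -> Prop :=
| A0 A : tautology A -> is_axiom A
| A1_Box A : S5_axiom (@Box Ag) A -> is_axiom A
| A1_Stit j A : S5_axiom (@Stit Ag j) A -> is_axiom A
| A2 j A : is_axiom (Box A =>> Stit j A)
| A3 (js : seq (Ag * form Ag)) :
    js <> [::] -> uniq (map fst js) ->
    is_axiom (bigAnd [seq Dia (Stit p.1 p.2) | p <- js]
                =>> Dia (bigAnd [seq Stit p.1 p.2 | p <- js]))
| A4 s t A B :
    is_axiom ((s ::: (A =>> B)) =>> (t ::: A) =>> (PProd s t ::: B))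
| A5 t A : is_axiom ((t ::: A) =>> (PBang t ::: t ::: A) &&& Know A)
| A6 s t A : is_axiom ((s ::: A) ||| (t ::: A) =>> (PSum s t ::: A))
| A7 A : S4_axiom (@Know Ag) A -> is_axiom A
| A8 A : is_axiom (Know A =>> Box (Know (Box A)))
| B9 j t A :
    is_axiom (Prove j t A =>>
      bigAnd [:: ~~~ Proven t A; Stit j (Prove j t A);
                 ~~~ Box (Prove j t A); t ::: A])
| B10 j t A B : is_axiom (Prove j t A &&& (t ::: B) =>> Prove j t B)
| B11 t A : is_axiom (Proven t A =>> Know (Proven t A) &&& (t ::: A))
| B12 t A B : is_axiom (Proven t A &&& (t ::: B) =>> Proven t B)
| B13 j t A :
    is_axiom (~~~ Prove j t A =>>
      DStit j (bigAnd [seq ~~~ Prove i t A | i <- enum Ag])).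

Definition const_spec (CS : set (form Ag)) : Prop :=
  (forall F, CS F -> exists (c : nat) (cs : seq nat) A,
      is_axiom A /\ F = foldr (fun c B => PConst c ::: B) A (c :: cs)) /\
  (forall (c d : nat) F,
      CS (PConst c ::: PConst d ::: F) -> CS (PConst d ::: F)).

Inductive provable (CS : set (form Ag)) : form Ag -> Prop :=
| Pr_axiom A : is_axiom A -> provable CS A
| Pr_MP A B : provable CS (A =>> B) -> provable CS A -> provable CS B
| Pr_Know A : provable CS A -> provable CS (Know A)
| Pr_Prove A (tB : seq (poly * form Ag)) :
    tB <> [::] ->
    provable CS (Know A =>> bigOr [seq ~~~ Proven p.1 p.2 | p <- tB]) ->
    provable CS (Know A =>>
      bigOr [seq bigAnd [seq ~~~ Prove j p.1 p.2 | j <- enum Ag] | p <- tB])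
| Pr_CS A : CS A -> provable CS A.

Definition consistent (CS Gamma : set (form Ag)) : Prop :=
  forall s : seq (form Ag),
    List.Forall Gamma s -> ~ provable CS (bigAnd s =>> Bot).

End ProofTheory.

(* Main.v *)
(* Soundness of the rule [Pr_Prove]: if [h] continues after [m], a proof presented
   at [(m, h)] belongs to [Act_moment] of any later moment of [h]; otherwise [h] is
   the only history through [m] and nothing can be [Prove]d there.

   Completeness: by [Pr_Prove], every maximal consistent set D has an epistemic
   successor in which everything [Prove]d in D is [Proven]; a successor with
   maximal knowledge then contains no [Prove] formula at all, and neither does any
   member of its [Box]-class.  The canonical tree has, above its root, a moment for
   the [Box]-class of each maximal consistent set G; above it, on the histories
   labelled D, only moments carrying the class of such a successor of D.
   Since a polynomial may become [Proven] in the successor without being presented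
   at G, and [no_new_proofs_guaranteed] asks for an earlier moment presenting it,
   these moments form trees with no least element, descending towards G.  The
   root presents, on the histories through G, the polynomials already [Proven] in
   G, and is accessible from no other moment, so it needs no truth lemma; nothing
   is settled at it because some G, the theory of a one-point model, has nothing
   [Proven]. *)

Require Import Defs.
From Stdlib Require Relation_Definitions List.
From mathcomp Require Import all_boot.
From mathcomp Require Import boolp classical_sets.

Set Implicit Arguments.
Unset Strict Implicit.
Unset Printing Implicit Defensive.

Local Open Scope classical_set_scope.

(** * List membership *)

Lemma In_map (T U : Type) (f : T -> U) (s : seq T) y :
  List.In y (map f s) <-> exists x, List.In x s /\ y = f x.
Proof.
rewrite (List.in_map_iff f s y : List.In y (map f s) <-> _).
by split=> -[x [xs sx]]; exists x.
Qed.

Lemma In_mem (T : eqType) (s : seq T) x : List.In x s <-> x \in s.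
Proof.
elim: s => [//|a s IH] /=; rewrite in_cons IH eq_sym.
by split=> [[->|->]|/orP[/eqP->|->]]; rewrite ?eqxx ?orbT //; [left|right].
Qed.

Lemma In_cat (T : Type) (s1 s2 : seq T) x :
  List.In x (s1 ++ s2) <-> List.In x s1 \/ List.In x s2.
Proof. exact: List.in_app_iff. Qed.

(** * Valuations and propositional tautologies *)

Section Valuations.
Variable Ag : Type.
Implicit Types (A B : form Ag) (s : seq (form Ag)).

(* Both truth at a point of a model and membership in a maximal consistent set
   are instances. *)
Record valuation (P : form Ag -> Prop) : Prop := Valuation {
  val_And : forall A B, P (And A B) <-> P A /\ P B;
  val_Neg : forall A, P (Neg A) <-> ~ P A
}.

Section Theory.
Variable P : form Ag -> Prop.
Hypothesis vP : valuation P.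

Lemma val_Imp A B : P (Imp A B) <-> (P A -> P B).
Proof.
rewrite (val_Neg vP) (val_And vP) (val_Neg vP); split=> [nAB PA|AB [PA]].
  by apply: contrapT => nB; exact: nAB.
by apply; exact: AB.
Qed.

Lemma val_Or A B : P (Or A B) <-> P A \/ P B.
Proof.
rewrite (val_Neg vP) (val_And vP) !(val_Neg vP); split=> [nAB|AB [nA nB]].
  have [PA|nA] := pselect (P A); first by left.
  by right; apply: contrapT => nB; exact: nAB.
by case: AB.
Qed.

Lemma val_Bot : ~ P Bot.
Proof. by rewrite (val_And vP) (val_Neg vP) => -[]. Qed.

Lemma val_bigAnd s : P (bigAnd s) <-> forall A, List.In A s -> P A.
Proof.
elim: s => [|A s IH].
  by split=> // _; apply/(val_Neg vP); exact: val_Bot.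
have -> : P (bigAnd (A :: s)) <-> P A /\ P (bigAnd s).
  case: s {IH} => [|B s]; last exact: val_And vP _ _.
  by split=> [PA|[//]]; split=> //; apply/(val_Neg vP); exact: val_Bot.
rewrite IH; split=> [[PA Ps] B /= [<-//|]|Ps]; first exact: Ps.
by split=> [|B sB]; apply: Ps; [left|right].
Qed.

Lemma val_bigOr s : P (bigOr s) <-> exists A, List.In A s /\ P A.
Proof.
elim: s => [|A s IH].
  by split=> [/val_Bot//|[A [[]]]].
have -> : P (bigOr (A :: s)) <-> P A \/ P (bigOr s).
  case: s {IH} => [|B s]; last exact: val_Or.
  by split=> [PA|[//|/val_Bot//]]; left.
rewrite IH; split=> [[PA|[B [sB PB]]]|[B [/= [->|sB] PB]]].
- by exists A; split=> //; left.
- by exists B; split=> //; right.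
- by left.
- by right; exists B.
Qed.

Lemma val_bigAnd_map (T : Type) (F : T -> form Ag) (s : seq T) :
  P (bigAnd [seq F x | x <- s]) <-> forall x, List.In x s -> P (F x).
Proof.
rewrite val_bigAnd; split=> [H x sx|H A /In_map[x [sx ->]]]; last exact: H.
by apply: H; apply/In_map; exists x.
Qed.

Lemma val_bigOr_map (T : Type) (F : T -> form Ag) (s : seq T) :
  P (bigOr [seq F x | x <- s]) <-> exists x, List.In x s /\ P (F x).
Proof.
rewrite val_bigOr; split=> [[A [/In_map[x [sx ->]] PA]]|[x [sx Px]]].
  by exists x.
by exists (F x); split=> //; apply/In_map; exists x.
Qed.

End Theory.

Lemma val_bigAnd_enum (T : finType) (P : form Ag -> Prop) (F : T -> form Ag) :
  valuation P ->
  P (bigAnd [seq F x | x <- enum T]) <-> forall x, P (F x).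
Proof.
move=> vP; rewrite (val_bigAnd_map vP); split=> [H x|H x _]; last exact: H.
by apply: H; apply/In_mem; rewrite mem_enum.
Qed.

End Valuations.

(** Lets propositional reasoning be carried out in the metalogic, on an arbitrary [Prop]-valued
    valuation; classical reflection turns such a valuation into a boolean one. *)
Lemma tautologyP (Ag : finType) (A : form Ag) :
  tautology A <-> forall P, valuation P -> P A.
Proof.
split=> [tA P vP|vA v]; last first.
  apply: (vA (fun B => beval v B)); split=> [B C|B] /=.
    by split=> [/andP|] // [-> ->].
  by split=> /negP.
have {tA} := tA (fun B => `[< P B >]).
have -> : beval (fun B => `[< P B >]) A = `[< P A >]; last by move/asboolP.
elim: A => //= [B -> C ->|B ->].
  rewrite -asbool_and; apply: asbool_equiv_eq; apply: iff_sym; exact: val_And.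
rewrite -asbool_neg; apply: asbool_equiv_eq; apply: iff_sym; exact: val_Neg.
Qed.

(** * Entailment, maximal consistent sets and Lindenbaum's lemma *)

Section Derivability.
Variables (Ag : finType) (CS : set (form Ag)).
Implicit Types (A B C : form Ag) (X Y : set (form Ag)).

Lemma provable_taut A : (forall P, valuation P -> P A) -> provable CS A.
Proof. by move=> /tautologyP tA; apply: Pr_axiom; exact: A0. Qed.

Lemma provable_conseq A B :
  (forall P, valuation P -> P A -> P B) -> provable CS A -> provable CS B.
Proof.
move=> AB; apply: Pr_MP; apply: provable_taut => P vP.
by apply/(val_Imp vP); exact: AB.
Qed.

Lemma provable_conseq2 A B C :
  (forall P, valuation P -> P A -> P B -> P C) ->
  provable CS A -> provable CS B -> provable CS C.
Proof.
move=> ABC pA; apply: Pr_MP; apply: provable_conseq pA => P vP PA.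
by apply/(val_Imp vP); exact: ABC.
Qed.

Definition entails X A :=
  exists2 s, (forall B, List.In B s -> X B) & provable CS (Imp (bigAnd s) A).

Lemma consistentE X : consistent CS X <-> ~ entails X Bot.
Proof.
split=> [cX [s /List.Forall_forall]|nX s /List.Forall_forall sX ps]; first exact: cX.
by apply: nX; exists s.
Qed.

Lemma entails_hyp X A : X A -> entails X A.
Proof.
move=> XA; exists [:: A] => [B /= [<-//|//]|].
by apply: provable_taut => P vP; apply/(val_Imp vP).
Qed.

Lemma entails_conseq X A B :
  (forall P, valuation P -> P A -> P B) -> entails X A -> entails X B.
Proof.
move=> AB [s sX sA]; exists s => //; apply: provable_conseq sA => P vP.
by rewrite !(val_Imp vP) => sA /sA; exact: AB.
Qed.

Lemma entails_provable X A : provable CS A -> entails X A.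
Proof.
move=> pA; exists [::] => //; apply: provable_conseq pA => P vP PA.
by apply/(val_Imp vP).
Qed.

Lemma entails_conseq2 X A B C :
  (forall P, valuation P -> P A -> P B -> P C) ->
  entails X A -> entails X B -> entails X C.
Proof.
move=> ABC [s sX sA] [r rX rB]; exists (s ++ r) => [D /In_cat[/sX|/rX]//|].
apply: provable_conseq2 sA rB => P vP.
rewrite !(val_Imp vP) !(val_bigAnd vP) => sA rB sr.
by apply: (ABC _ vP); [apply: sA|apply: rB] => D D_in; apply: sr; apply/In_cat; auto.
Qed.

(** Induction on the premises, with [B] general: a premise [C] is moved to the right of the
    implication, then discharged if it is in [X] or contracted with [A] if it equals [A]. *)
Lemma entails_deduction X A B :
  entails (X `|` [set A]) B -> entails X (Imp A B).
Proof.
move=> [s]; elim: s B => [|C s IH] B sX sB.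
  apply: entails_provable; apply: provable_conseq sB => P vP.
  by rewrite !(val_Imp vP) => + _; apply.
have /IH {}IH : forall D, List.In D s -> (X `|` [set A]) D.
  by move=> D sD; apply: sX; right.
have /IH {}IH : provable CS (Imp (bigAnd s) (Imp C B)).
  apply: provable_conseq sB => P vP; rewrite !(val_Imp vP) !(val_bigAnd vP).
  by move=> H Ps PC; apply: H => D /= [<-//|]; exact: Ps.
have [XC|/= CA] := sX C (or_introl erefl).
  apply: entails_conseq2 IH (entails_hyp XC) => P vP.
  by rewrite !(val_Imp vP) => H PC PA; exact: H.
apply: entails_conseq IH => P vP.
by rewrite !(val_Imp vP) CA => H PA; exact: H.
Qed.

Lemma entails_sub X Y A : X `<=` Y -> entails X A -> entails Y A.
Proof. by move=> XY [s sX sA]; exists s => // B /sX /XY. Qed.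

(** A derivation has finitely many premises, so in a chain those outside [X] lie in one member;
    consistency of [X] itself covers the derivations that use no member, as for the empty chain. *)
Lemma consistent_bigcup X (F : set (set (form Ag))) :
  consistent CS X -> (forall Y, F Y -> consistent CS (X `|` Y)) ->
  total_on F subset -> consistent CS (X `|` \bigcup_(Y in F) Y).
Proof.
move=> cX cF totF; apply/consistentE => -[s sXF ps].
have : (forall A, List.In A s -> X A) \/
    exists2 Y, F Y & forall A, List.In A s -> (X `|` Y) A.
  elim: s {ps} sXF => [|A s IH] sXF; first by left.
  have {}IH := IH (fun B sB => sXF B (or_intror sB)).
  have [XA|[Y FY YA]] := sXF A (or_introl erefl).
    case: IH => [sX|[Y FY sY]]; first by left=> B /= [<-//|]; exact: sX.
    by right; exists Y => // B /= [<-|/sY//]; left.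
  right; case: IH => [sX|[Z FZ sZ]].
    by exists Y => // B /= [<-|/sX]; [right|left].
  have [YZ|ZY] := totF _ _ FY FZ.
    by exists Z => // B /= [<-|/sZ//]; right; exact: YZ.
  by exists Y => // B /= [<-|/sZ[|/ZY]]; [right|left|right].
case=> [sX|[Y FY sY]].
  by move/consistentE: cX; apply; exists s.
by move/consistentE: (cF _ FY); apply; exists s.
Qed.

Record mcs : Type := Mcs {
  theory :> form Ag -> Prop;
  mcs_consistent : consistent CS theory;
  mcs_complete : forall A, theory A \/ theory (Neg A)
}.
Implicit Types G D : mcs.

Lemma consistent_sub X G : X `<=` theory G -> consistent CS X.
Proof.
move=> XG; apply/consistentE => /(entails_sub XG).
exact: ((consistentE _).1 (@mcs_consistent G)).
Qed.

Lemma mcs_entails G A : entails (theory G) A -> G A.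
Proof.
move=> GA; case: (mcs_complete G A) => // GnA.
case: ((consistentE G).1 (@mcs_consistent G)).
apply: entails_conseq2 GA (entails_hyp GnA) => P vP PA /(val_Neg vP).
by [].
Qed.

Lemma mcs_provable G A : provable CS A -> G A.
Proof. by move=> pA; apply: mcs_entails; exact: entails_provable. Qed.

Lemma mcs_valuation G : valuation G.
Proof.
have cons A B : (forall P, valuation P -> P A -> P B) -> G A -> G B.
  move=> AB GA; apply: mcs_entails; exact: entails_conseq AB (entails_hyp GA).
split=> [A B|A].
  split=> [GAB|[GA GB]].
    by split; apply: cons GAB => P vP /(val_And vP)[].
  apply: mcs_entails; apply: entails_conseq2 (entails_hyp GA) (entails_hyp GB).
  by move=> P vP PA PB; apply/(val_And vP).
split=> [GnA GA|]; last by case: (mcs_complete G A).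
case: ((consistentE G).1 (@mcs_consistent G)).
apply: entails_conseq2 (entails_hyp GA) (entails_hyp GnA).
by move=> P vP PA /(val_Neg vP).
Qed.

Lemma mcs_Imp G A B : provable CS (Imp A B) -> G A -> G B.
Proof. by move=> /(mcs_provable G) /(val_Imp (mcs_valuation G)). Qed.

Lemma mcs_axiom G A B : is_axiom (Imp A B) -> G A -> G B.
Proof. by move=> /(@Pr_axiom _ CS); exact: mcs_Imp. Qed.

Lemma lindenbaum X : consistent CS X -> exists G, X `<=` theory G.
Proof.
move=> cX.
(* Zorn ranges over the sets added to [X], not over the supersets of [X], so that the empty union
   qualifies. *)
have [F|Y [cY maxY]] := @Zorn_bigcup _ [set Y | consistent CS (X `|` Y)].
  by move=> FP totF; apply: consistent_bigcup.
have maxA A : ~ entails (X `|` Y `|` [set A]) Bot -> Y A.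
  move=> /consistentE cA; apply: contrapT => nYA.
  apply: (maxY (Y `|` [set A])); last by rewrite /= setUA.
  split; first by move=> B YB; left.
  by move=> /(_ A) /= H; apply: nYA; apply: H; right.
have cXY : ~ entails (X `|` Y) Bot by apply/consistentE.
have compl A : (X `|` Y) A \/ (X `|` Y) (Neg A).
  have [/maxA YA|/contrapT hA] := pselect (~ entails (X `|` Y `|` [set A]) Bot).
    by left; right.
  have [/maxA YA|/contrapT hnA] :=
      pselect (~ entails (X `|` Y `|` [set Neg A]) Bot).
    by right; right.
  case: cXY; apply: entails_conseq2 (entails_deduction hA) (entails_deduction hnA).
  move=> P vP; rewrite !(val_Imp vP) (val_Neg vP) => nA; apply=> PA.
  exact: val_Bot vP (nA PA).
by exists (Mcs cY compl) => A XA; left.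
Qed.

Lemma mcs_avoiding X A : ~ entails X A -> exists G, X `<=` theory G /\ ~ G A.
Proof.
move=> nXA.
have /lindenbaum[G XG] : consistent CS (X `|` [set Neg A]).
  apply/consistentE => /entails_deduction XnA; apply: nXA.
  apply: entails_conseq XnA => P vP.
  rewrite (val_Imp vP) (val_Neg vP) => H; apply: contrapT => nA.
  by apply: (val_Bot vP); exact: H.
exists G; split=> [B XB|]; first by apply: XG; left.
by apply/(val_Neg (mcs_valuation G)); apply: XG; right.
Qed.

End Derivability.

(** * Canonical relations between maximal consistent sets *)

Section CanonicalRelations.
Variables (Ag : finType) (CS : set (form Ag)).
Implicit Types (A B C : form Ag) (X Y : set (form Ag)) (G D : mcs CS).
Local Notation provable := (provable CS).
Local Notation entails := (entails CS).

(** Necessitation for [Box] is not a rule; it comes from the one for [Know] through A8, stripping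
    two operators by reflexivity. *)
Lemma provable_Box A : provable A -> provable (Box A).
Proof.
move=> pA; apply: (@Pr_MP _ _ (Know (Box A))).
  by apply: Pr_axiom; apply: A7; exact: S4_T.
apply: (@Pr_MP _ _ (Box (Know (Box A)))).
  by apply: Pr_axiom; apply: A1_Box; apply: S5_S4; exact: S4_T.
apply: (@Pr_MP _ _ (Know A)); last exact: Pr_Know.
by apply: Pr_axiom; exact: A8.
Qed.

Lemma provable_Stit j A : provable A -> provable (Stit j A).
Proof.
by move=> /provable_Box; apply: Pr_MP; apply: Pr_axiom; exact: A2.
Qed.

Definition acc (box : form Ag -> form Ag) G D := forall A, G (box A) -> D A.

(** For an S5 operator this coincides with [acc], and it is an equivalence for any operator. *)
Definition eqv (box : form Ag -> form Ag) G D := forall A, G (box A) <-> D (box A).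

Lemma eqv_refl box G : eqv box G G.
Proof. by []. Qed.

Lemma eqv_sym box G D : eqv box G D -> eqv box D G.
Proof. by move=> GD A; apply: iff_sym. Qed.

Lemma eqv_trans box G D E : eqv box G D -> eqv box D E -> eqv box G E.
Proof. by move=> GD DE A; apply: iff_trans (DE A). Qed.

Section S4.
Variable box : form Ag -> form Ag.
Hypothesis nec : forall A, provable A -> provable (box A).
Hypothesis S4 : forall A, S4_axiom box A -> provable A.

(** Necessitate the derivation once its premises have been turned into nested antecedents; axiom K
    then discharges them one at a time. *)
Lemma entails_box G X A :
  (forall B, X B -> G (box B)) -> entails X A -> G (box A).
Proof.
move=> XG [s]; elim: s A => [|C s IH] A sX sA.
  apply: mcs_provable; apply: nec; apply: provable_conseq sA => P vP.
  by rewrite !(val_Imp vP); apply.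
have /IH : provable (Imp (bigAnd s) (Imp C A)).
  apply: provable_conseq sA => P vP; rewrite !(val_Imp vP) !(val_bigAnd vP).
  by move=> H Ps PC; apply: H => D /= [<-//|]; exact: Ps.
have {sX} [/XG GC sX] : X C /\ forall B, List.In B s -> X B.
  by split=> [|B sB]; apply: sX; [left|right].
move=> /(_ sX) /(mcs_Imp (S4 (S4_K _ _ _))).
by move=> /(val_Imp (mcs_valuation G)); apply.
Qed.

Lemma box_elim G A : G (box A) -> G A.
Proof. exact: mcs_Imp (S4 (S4_T _ _)). Qed.

Lemma box_idem G A : G (box A) -> G (box (box A)).
Proof. exact: mcs_Imp (S4 (S4_4 _ _)). Qed.

Lemma acc_boxP G A : G (box A) <-> forall D, acc box G D -> D A.
Proof.
split=> [GA D|H]; first exact.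
apply: contrapT => nGA.
have /mcs_avoiding[D [GD nDA]] : ~ entails [set B | G (box B)] A.
  by move=> /entails_box GA; apply: nGA; exact: GA.
by apply: nDA; exact: H.
Qed.

Lemma eqv_acc G D : eqv box G D -> acc box G D.
Proof. by move=> GD A /GD; exact: box_elim. Qed.

Lemma acc_box G D A : acc box G D -> G (box A) -> D (box A).
Proof. by move=> GD /box_idem /GD. Qed.

Lemma eqv_boxW G D A : eqv box G D -> G (box A) -> D A.
Proof. by move=> /eqv_acc; apply. Qed.

Hypothesis S5 : forall A, S5_axiom box A -> provable A.

Lemma acc_eqv G D : acc box G D -> eqv box G D.
Proof.
move=> GD A; split; first exact: acc_box.
move=> DA; apply: contrapT => /(val_Neg (mcs_valuation G)).
move=> /(mcs_Imp (S5 (S5_5 _ _))) /GD /(val_Neg (mcs_valuation D)).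
exact.
Qed.

Lemma eqv_boxP G A : G (box A) <-> forall D, eqv box G D -> D A.
Proof.
rewrite acc_boxP; split=> H D GD; apply: H; first exact: eqv_acc.
exact: acc_eqv.
Qed.

End S4.

Lemma S5_Box A : S5_axiom (@Box Ag) A -> provable A.
Proof. by move=> ?; apply: Pr_axiom; exact: A1_Box. Qed.

Lemma S4_Box A : S4_axiom (@Box Ag) A -> provable A.
Proof. by move=> ?; apply: S5_Box; exact: S5_S4. Qed.

Lemma S5_Stit j A : S5_axiom (@Stit Ag j) A -> provable A.
Proof. by move=> ?; apply: Pr_axiom; exact: (@A1_Stit _ j). Qed.

Lemma S4_Stit j A : S4_axiom (@Stit Ag j) A -> provable A.
Proof. by move=> ?; apply: (@S5_Stit j); exact: S5_S4. Qed.

Lemma S4_Know A : S4_axiom (@Know Ag) A -> provable A.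
Proof. by move=> ?; apply: Pr_axiom; exact: A7. Qed.

Lemma BoxP G A : G (Box A) <-> forall D, eqv (@Box Ag) G D -> D A.
Proof. exact: eqv_boxP provable_Box S4_Box S5_Box _ _. Qed.

Lemma StitP j G A : G (Stit j A) <-> forall D, eqv (Stit j) G D -> D A.
Proof. exact: eqv_boxP (@provable_Stit j) (@S4_Stit j) (@S5_Stit j) _ _. Qed.

Lemma KnowP G A : G (Know A) <-> forall D, acc (@Know Ag) G D -> D A.
Proof. exact: acc_boxP (@Pr_Know _ _) S4_Know _ _. Qed.

Lemma Know_elim G A : G (Know A) -> G A.
Proof. exact: box_elim S4_Know _ _. Qed.

Lemma acc_Know G D A : acc (@Know Ag) G D -> G (Know A) -> D (Know A).
Proof. exact: (acc_box S4_Know). Qed.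

Lemma acc_Know_refl G : acc (@Know Ag) G G.
Proof. by move=> A; exact: Know_elim. Qed.

Lemma acc_Know_trans G D E :
  acc (@Know Ag) G D -> acc (@Know Ag) D E -> acc (@Know Ag) G E.
Proof. by move=> GD DE A /(acc_Know GD) /DE. Qed.

(** By A8, [Know A] yields [Box (Know (Box A))], so knowledge is the same throughout a
    [Box]-class. *)
Lemma eqv_Box_acc_Know G D : eqv (@Box Ag) G D -> acc (@Know Ag) G D.
Proof.
move=> GD A /(mcs_axiom (A8 _)) /(eqv_boxW S4_Box GD) /Know_elim.
exact: box_elim S4_Box _ _.
Qed.

Lemma eqv_Stit_Box j G D : eqv (Stit j) G D -> eqv (@Box Ag) G D.
Proof.
move=> GD; apply: acc_eqv; [exact: S4_Box|exact: S5_Box|] => A.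
by move=> /(mcs_axiom (A2 j _)); exact: eqv_boxW (@S4_Stit j) _ _ _ GD.
Qed.

Lemma Just_PBang G t A : G (Just t A) -> G (Just (PBang t) (Just t A)) /\ G (Know A).
Proof. by move=> /(mcs_axiom (A5 _ _)) /(val_And (mcs_valuation G)). Qed.

(** A5 is used twice: first for [t], then for [PBang t], which justifies [Just t A] and hence makes
    it known. *)
Lemma Just_Know G t A : G (Just t A) -> G (Know (Just t A)).
Proof. by move=> /Just_PBang[/Just_PBang[]]. Qed.

Lemma Proven_Just G t A :
  G (Proven t A) -> G (Know (Proven t A)) /\ G (Just t A).
Proof. by move=> /(mcs_axiom (B11 _ _)) /(val_And (mcs_valuation G)). Qed.

Lemma acc_Just G D t A : acc (@Know Ag) G D -> G (Just t A) -> D (Just t A).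
Proof. by move=> GD /Just_Know /GD. Qed.

Lemma acc_Proven G D t A : acc (@Know Ag) G D -> G (Proven t A) -> D (Proven t A).
Proof. by move=> GD /Proven_Just[/GD]. Qed.

Lemma Proven_transfer G t A B : G (Proven t A) -> G (Just t B) -> G (Proven t B).
Proof.
by move=> GA GB; apply: (mcs_axiom (B12 t A B)); apply/(val_And (mcs_valuation G)).
Qed.

Lemma Prove_transfer G j t A B :
  G (Prove j t A) -> G (Just t B) -> G (Prove j t B).
Proof.
by move=> GA GB; apply: (mcs_axiom (B10 j t A B)); apply/(val_And (mcs_valuation G)).
Qed.

Lemma ProveE G j t A : G (Prove j t A) ->
  [/\ ~ G (Proven t A), G (Stit j (Prove j t A)), ~ G (Box (Prove j t A))
    & G (Just t A)].
Proof.
have vG := mcs_valuation G.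
move=> /(mcs_axiom (B9 j t A)) /(val_bigAnd vG) H.
have [H1 H2] : G (Neg (Proven t A)) /\ G (Neg (Box (Prove j t A))).
  by split; apply: H => /=; auto.
split; [exact/(val_Neg vG)| |exact/(val_Neg vG)|]; apply: H => /=; auto.
Qed.

Lemma not_Prove G j t A : ~ G (Prove j t A) ->
  exists D, eqv (Stit j) G D /\ forall i, ~ D (Prove i t A).
Proof.
move=> /(val_Neg (mcs_valuation G)) /(mcs_axiom (B13 j t A)).
move=> /(val_Neg (mcs_valuation G)) nG; apply: contrapT => H; apply: nG.
apply/StitP => D GD; apply/(val_Neg (mcs_valuation D)).
move=> /(val_bigAnd_enum _ (mcs_valuation D)) nD; apply: H; exists D; split=> // i.
by apply/(val_Neg (mcs_valuation D)); exact: nD.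
Qed.

Definition proven G : set poly := [set t | exists A, G (Proven t A)].

Definition being_proved G : set poly := [set t | exists j A, G (Prove j t A)].

Lemma acc_proven G D : acc (@Know Ag) G D -> proven G `<=` proven D.
Proof. by move=> GD t [A /(acc_Proven GD)]; exists A. Qed.

(** B13 gives a member of the cell where no agent proves [A] by [t]. B10 extends this to every
    formula, since [Just t A] is known; nothing new is [Proven] there, since the whole class shares
    its knowledge. *)
Lemma cell_without_proof G j t A :
  G (Just t A) -> ~ proven G t -> ~ G (Prove j t A) ->
  exists D, eqv (Stit j) G D /\ ~ (proven D `|` being_proved D) t.
Proof.
move=> GA nGt /not_Prove[D [GD nD]]; exists D; split=> //.
have /eqv_Stit_Box GD' := GD.
case=> [|[i [B /Prove_transfer DB]]]; last first.
  by apply: (nD i); apply: DB; apply: acc_Just GA; exact: eqv_Box_acc_Know.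
by move/(acc_proven (eqv_Box_acc_Know (eqv_sym GD'))).
Qed.

(** If some agent proves by [t] in [G], B9 says that this is not settled; where it fails,
    [cell_without_proof] applies. *)
Lemma class_without_proof G t : ~ proven G t ->
  exists D, eqv (@Box Ag) G D /\ ~ (proven D `|` being_proved D) t.
Proof.
move=> nGt; have [[j [A GA]]|nG] := pselect (being_proved G t); last first.
  by exists G; split=> // -[].
have [_ _ nBox GtA] := ProveE GA.
have [D GD nD] : exists2 D, eqv (@Box Ag) G D & ~ D (Prove j t A).
  apply: contrapT => H; apply: nBox; apply/BoxP => D GD.
  by apply: contrapT => nD; apply: H; exists D.
have GDK := eqv_Box_acc_Know GD.
have DGK := eqv_Box_acc_Know (eqv_sym GD).
have [|E [DE nE]] := cell_without_proof (acc_Just GDK GtA) _ nD.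
  by move/(acc_proven DGK).
by exists E; split=> //; apply: eqv_trans GD _; exact: eqv_Stit_Box DE.
Qed.

(* This is where the rule [Pr_Prove] is used. *)
Lemma successor_consistent D :
  consistent CS ([set B | D (Know B)] `|`
    [set B | exists j t A, B = Proven t A /\ D (Prove j t A)]).
Proof.
have vD := mcs_valuation D.
apply/consistentE => -[s sX sBot].
(* The known premises are merged into one formula [A], the others are listed as pairs [tB]; the
   inconsistency then has the shape of the premise of [Pr_Prove]. *)
suff [A [tB [DA DtB AtB]]] : exists A tB, [/\ D (Know A),
    forall p, List.In p tB -> exists j, D (Prove j p.1 p.2)
    & forall P, valuation P -> P A ->
        (forall p, List.In p tB -> P (Proven p.1 p.2)) -> P (bigAnd s)].
  have KA : provable (Imp (Know A) (bigOr [seq Neg (Proven p.1 p.2) | p <- tB])).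
    apply: provable_conseq2 (S4_Know (S4_T _ A)) sBot => P vP.
    rewrite !(val_Imp vP) (val_bigOr_map vP) => KA nS PKA.
    apply: contrapT => H; apply: (val_Bot vP); apply: nS.
    apply: AtB => // [|p tBp]; first exact: KA.
    by apply: contrapT => /(val_Neg vP) np; apply: H; exists p.
  (* [Pr_Prove] asks for a nonempty list; when [tB] is empty the disjunction is [Bot], and [KA]
     already contradicts [DA]. *)
  have [tB0|tB0] := pselect (tB = [::]).
    by move: KA; rewrite tB0 => /mcs_Imp /(_ DA); exact: val_Bot.
  have /mcs_Imp /(_ DA) := Pr_Prove tB0 KA.
  move=> /(val_bigOr_map vD)[p [tBp /(val_bigAnd_enum _ vD) np]].
  have [j Dj] := DtB p tBp.
  by have /(val_Neg vD) := np j.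
elim: s sX {sBot} => [|C s IH] sX.
  exists Top, [::]; split=> //.
  by apply: mcs_provable; apply: Pr_Know; apply: provable_taut => P vP;
     apply/(val_bigAnd vP [::]).
have [B sB|A [tB [DA DtB AtB]]] := IH; first by apply: sX; right.
have [DC|[j [t [B [-> DB]]]]] := sX C (or_introl erefl).
  exists (And A C), tB; split=> //.
    apply/KnowP => E DE; apply/(val_And (mcs_valuation E)).
    by split; exact: DE.
  move=> P vP /(val_And vP)[PA PC] PtB; apply/(val_bigAnd vP) => B /= [<-//|].
  by move: B; apply/(val_bigAnd vP); exact: AtB.
exists A, ((t, B) :: tB); split=> // [p /= [<-|/DtB//]|P vP PA PtB].
  by exists j.
apply/(val_bigAnd vP) => E /= [<-|]; first by apply: (PtB (t, B)); left.
by move: E; apply/(val_bigAnd vP); apply: AtB => // p tBp; apply: PtB; right.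
Qed.

Definition know_maximal G :=
  forall D, acc (@Know Ag) G D -> acc (@Know Ag) D G.

Lemma know_maximal_eqv G D :
  eqv (@Box Ag) G D -> know_maximal G -> know_maximal D.
Proof.
move=> GD maxG E DE; apply: acc_Know_trans (maxG E _) _.
  exact: acc_Know_trans (eqv_Box_acc_Know GD) _.
exact: eqv_Box_acc_Know.
Qed.

(** What [G] proves becomes [Proven] in some successor; by maximality that knowledge flows back to
    [G], against B9. *)
Lemma know_maximal_being_proved G : know_maximal G -> being_proved G = set0.
Proof.
move=> maxG; apply/seteqP; split=> // t [j [A GA]].
have [D DG] := lindenbaum (@successor_consistent G).
have GD : acc (@Know Ag) G D by move=> B GB; apply: DG; left.
have [nG _ _ _] := ProveE GA; apply: nG.
by apply: acc_Proven (maxG _ GD) _; apply: DG; right; exists j, t, A.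
Qed.

Lemma successor_exists D : exists G,
  [/\ acc (@Know Ag) D G, being_proved D `<=` proven G & know_maximal G].
Proof.
set X := [set B | D (Know B)] `|`
    [set B | exists j t A, B = Proven t A /\ D (Prove j t A)].
have cX : consistent CS X by exact: successor_consistent.
(* Only [Know] formulas are added to [X], so a maximal [Y] leaves no further knowledge to gain
   beyond an extension of [X] and [Y]. *)
have [F FP totF|Y [[YK cY] maxY]] := @Zorn_bigcup _
    [set Y | Y `<=` range (@Know Ag) /\ consistent CS (X `|` Y)].
  split; first by move=> A [Y FY YA]; have [YK _] := FP Y FY; exact: YK.
  by apply: consistent_bigcup => // Y /FP[].
have [G XYG] := lindenbaum cY.
(* Members of [X] are even known in [G], by transitivity of [Know] or by B11, and so persist to
   every successor of [G]. *)
have XKG A : X A -> G (Know A).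
  case=> [DA|[j [t [B [-> DB]]]]].
    by apply: XYG; left; left; exact: box_idem S4_Know _ _ DA.
  by have /Proven_Just[] : G (Proven t B) by apply: XYG; left; right; exists j, t, B.
exists G; split.
- by move=> A DA; apply: XYG; left; left.
- by move=> t [j [A DA]]; exists A; apply: XYG; left; right; exists j, t, A.
(* [E] contains [X], [Y] and [Know A], so [Y] enlarged by [Know A] is still admissible and
   maximality of [Y] applies. *)
- move=> E GE A EA; apply: Know_elim; apply: (XYG); right; apply: contrapT => nYA.
  apply: (maxY (Y `|` [set Know A])).
    split=> [B YB|/(_ (Know A)) H]; first by left.
    by apply: nYA; apply: H; right.
  split=> [B [/YK//|->]|]; first by exists A.
  apply: (@consistent_sub _ _ _ E) => B [XB|[YB|->//]].
    by apply: GE; exact: XKG.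
  by have [C _ KC] := YK B YB; rewrite -KC; apply: acc_Know GE _; apply: XYG; right; rewrite KC.
Qed.

Lemma mcs_independence G (f : Ag -> mcs CS) :
  (forall j, eqv (@Box Ag) G (f j)) ->
  exists D, eqv (@Box Ag) G D /\ forall j, eqv (Stit j) (f j) D.
Proof.
(* A3 needs a nonempty list of agents; without agents [G] itself is the answer. *)
move=> Gf; have [[j0 _]|noAg] := pselect (exists j : Ag, True); last first.
  by exists G; split=> // j; case: noAg; exists j.
have vG := mcs_valuation G.
suff /lindenbaum[D fD] : consistent CS
    [set B | exists j A, B = Stit j A /\ f j (Stit j A)].
  have eD j : eqv (Stit j) (f j) D.
    apply: acc_eqv; [exact: S4_Stit|exact: S5_Stit|] => A fA.
    by apply: (box_elim (@S4_Stit j)); apply: fD; exists j, A.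
  by exists D; split=> //; apply: eqv_trans (Gf j0) (eqv_Stit_Box (eD j0)).
apply/consistentE => -[s sX sBot].
(* A3 takes one formula per agent, so the finitely many premises of each agent are conjoined under a
   single [Stit], starting from [Top]. *)
have [a [fa aS]] : exists a : Ag -> form Ag, (forall j, f j (Stit j (a j))) /\
    forall D, (forall j, D (Stit j (a j))) -> forall B, List.In B s -> D B.
  elim: s sX {sBot} => [|C s IH] sX.
    exists (fun=> Top); split=> // j; apply: mcs_provable; apply: provable_Stit.
    by apply: provable_taut => P vP; apply/(val_bigAnd vP [::]).
  have [B sB|a [fa aS]] := IH; first by apply: sX; right.
  have [j [A [-> fA]]] := sX C (or_introl erefl).
  exists (fun i => if i == j then And (a j) A else a i); split=> [i|D Da].
    case: eqP => // ->; apply/StitP => E jE; apply/(val_And (mcs_valuation E)).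
    by split; apply: (eqv_boxW (@S4_Stit j) jE).
  have /StitP Dj := Da j; rewrite eqxx in Dj.
  move=> B /= [<-|].
    by apply/StitP => E /Dj /(val_And (mcs_valuation E))[].
  move: B; apply: aS => i; have [->|ij] := pselect (i = j).
    by apply/StitP => E /Dj /(val_And (mcs_valuation E))[].
  by have := Da i; case: eqP.
pose js := [seq (j, a j) | j <- enum Ag].
have js0 : js <> [::].
  have : j0 \in enum Ag by rewrite mem_enum.
  by rewrite /js; case: (enum Ag).
have ujs : uniq (map fst js).
  by rewrite /js -map_comp map_id_in ?enum_uniq.
have H := @mcs_axiom _ CS G _ _ (A3 js0 ujs).
have mapjs (F : Ag * form Ag -> form Ag) :
    [seq F p | p <- js] = [seq F (j, a j) | j <- enum Ag] by rewrite -map_comp.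
rewrite !mapjs /= in H.
have {H} : G (Dia (bigAnd [seq Stit j (a j) | j <- enum Ag])).
  apply: H; apply/(val_bigAnd_enum _ vG) => j; apply/(val_Neg vG) => /BoxP.
  move=> /(_ _ (Gf j)) /(val_Neg (mcs_valuation _)); exact.
move=> /(val_Neg vG); apply; apply/BoxP => D GD.
have vD := mcs_valuation D; apply/(val_Neg vD) => /(val_bigAnd_enum _ vD) Da.
apply: (val_Bot vD); apply: (mcs_Imp sBot).
by apply/(val_bigAnd vD); exact: aS.
Qed.

End CanonicalRelations.

(** * Maximal chains in tree-like orders *)

Section MaximalChains.
Variables (T : Type) (le : T -> T -> Prop).

(** The notion of [history] for an arbitrary relation, to serve both for given models and for the
    canonical tree. *)
Definition maximal_chain (h : set T) : Prop :=
  total_on h le /\ forall h', total_on h' le -> h `<=` h' -> h' = h.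

Lemma maximal_chain_exists (c : set T) :
  total_on c le -> exists h, maximal_chain h /\ c `<=` h.
Proof.
move=> totc; have [F FP totF|Y [totY maxY]] :=
    @Zorn_bigcup _ [set Y | total_on (c `|` Y) le].
  move=> x y [cx|[X FX Xx]] [cy|[Y FY Yy]].
  - exact: totc.
  - by apply: (FP _ FY); [left|right].
  - by apply: (FP _ FX); [right|left].
  - have [XY|YX] := totF _ _ FX FY.
      by apply: (FP _ FY); right=> //; exact: XY.
    by apply: (FP _ FX); right=> //; exact: YX.
exists (c `|` Y); split; last by move=> x cx; left.
split=> // h' toth' Yh'; apply: contrapT => h'Y.
apply: (maxY h'); last first.
  by rewrite /= setUidr // => x cx; apply: Yh'; left.
split=> [x Yx|h'sub]; first by apply: Yh'; right.
by apply: h'Y; apply/seteqP; split=> // x /h'sub; right.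
Qed.

Lemma maximal_chain_total h x y :
  maximal_chain h -> h x -> h y -> le x y \/ le y x.
Proof. by move=> [toth _]; exact: toth. Qed.

Hypothesis le_refl : forall x, le x x.
Hypothesis le_trans : forall x y z, le x y -> le y z -> le x z.
Hypothesis nbb : forall x y z, le y x -> le z x -> le y z \/ le z y.

Lemma maximal_chain_in h x : maximal_chain h ->
  (forall y, h y -> le x y \/ le y x) -> h x.
Proof.
move=> [toth maxh] xh; rewrite -(maxh (h `|` [set x])); first by right.
  move=> y z [hy|->] [hz|->]; first exact: toth.
  - by have [|] := xh y hy; auto.
  - exact: xh.
  - by left; exact: le_refl.
by move=> y hy; left.
Qed.

Lemma maximal_chain_down h x y : maximal_chain h -> h x -> le y x -> h y.
Proof.
move=> hh hx yx; apply: (maximal_chain_in hh) => z hz.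
have [xz|zx] := maximal_chain_total hh hx hz; last exact: nbb yx zx.
by left; exact: le_trans yx xz.
Qed.

(** A member of [g] below [x] is in [h] by downward closure; one above [x] is above all of [h],
    hence in [h] by maximality. *)
Lemma maximal_chain_leaf h g x : maximal_chain h -> maximal_chain g ->
  h x -> g x -> (forall y, h y -> le x y -> y = x) -> g = h.
Proof.
move=> hh hg hx gx leaf; apply/esym.
have [_ maxg] := hg; apply: maxg; first by case: hh.
move=> y gy; have [xy|yx] := maximal_chain_total hg gx gy; last first.
  exact: maximal_chain_down hx yx.
apply: (maximal_chain_in hh) => z hz; right.
have [xz|zx] := maximal_chain_total hh hx hz; last exact: le_trans zx xy.
by rewrite (leaf _ hz xz).
Qed.

End MaximalChains.

(** * Soundness of S4 and S5 over Kripke frames *)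

Section ModalSoundness.
Variables (Ag : finType) (box : form Ag -> form Ag).
Variables (W : Type) (dom : W -> Prop) (S : W -> W -> Prop).
Variable ev : W -> form Ag -> Prop.
Hypothesis ev_val : forall w, valuation (ev w).
Hypothesis ev_box : forall w A, dom w ->
  ev w (box A) <-> forall u, S w u -> ev u A.
Hypothesis S_dom : forall w u, dom w -> S w u -> dom u.
Hypothesis S_refl : forall w, dom w -> S w w.
Hypothesis S_trans : forall w u v, dom w -> S w u -> S u v -> S w v.

(** The predicate [dom] singles out genuine histories among sets of moments. Worlds are histories
    for [Box] and [Stit], and moment-history pairs for [Know]. *)
Lemma S4_sound A w : S4_axiom box A -> dom w -> ev w A.
Proof.
case=> {}A.
- move=> B Dw; rewrite !(val_Imp (ev_val w)) !ev_box // => AB PA u wu.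
  by move: (AB u wu); rewrite (val_Imp (ev_val u)); apply; exact: PA.
- by move=> Dw; rewrite (val_Imp (ev_val w)) ev_box //; apply; exact: S_refl.
- move=> Dw; rewrite (val_Imp (ev_val w)) !ev_box // => PA u wu.
  rewrite ev_box; last exact: S_dom wu.
  by move=> v uv; apply: PA; exact: S_trans wu uv.
Qed.

Hypothesis S_sym : forall w u, dom w -> S w u -> S u w.

Lemma S5_sound A w : S5_axiom box A -> dom w -> ev w A.
Proof.
case=> {}A; first exact: S4_sound.
move=> Dw; rewrite (val_Imp (ev_val w)) (val_Neg (ev_val w)) !ev_box //.
move=> nA u wu; have Du := S_dom Dw wu.
rewrite (val_Neg (ev_val u)) ev_box // => PA; apply: nA => v wv; apply: PA.
exact: S_trans (S_sym Dw wu) wv.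
Qed.

End ModalSoundness.

(** * Soundness for jstit models *)

Section Soundness.
Variables (Ag : finType) (M : jstit_structure Ag).
Hypothesis hM : is_jstit_model M.
Implicit Types (m : moment M) (h g : set (moment M)) (j : Ag) (A B : form Ag).

Lemma mom_refl m : le_mom m m.
Proof. by case: (le_mom_order hM). Qed.

Lemma mom_trans m1 m2 m3 : le_mom m1 m2 -> le_mom m2 m3 -> le_mom m1 m3.
Proof. by case: (le_mom_order hM) => _ H _; exact: H. Qed.

Lemma Hist_down m m' h : Hist m h -> le_mom m' m -> Hist m' h.
Proof.
move=> [hh hm] m'm; split=> //.
exact: (maximal_chain_down mom_refl mom_trans (@no_backward_branching _ _ hM) hh hm).
Qed.

Lemma cellE m j h (C : set (set (moment M))) :
  Defs.Choice m j C -> C h -> cell m j h = C.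
Proof.
have [_ trivC _] := Choice_partition hM m j.
move=> mC Ch; apply/seteqP; split=> [g [C' [mC' C'h] C'g]|g Cg].
  by rewrite (trivC C C') //; exists h.
by exists C.
Qed.

Lemma Choice_cell m j h : Hist m h -> Defs.Choice m j (cell m j h) /\ cell m j h h.
Proof.
have [covC _ _] := Choice_partition hM m j.
by rewrite -covC => -[C mC Ch]; rewrite (cellE mC Ch).
Qed.

Lemma Choice_Hist m j (C : set (set (moment M))) : Defs.Choice m j C -> C `<=` Hist m.
Proof.
by have [<- _ _] := Choice_partition hM m j => mC h Ch; exists C.
Qed.

Lemma cell_Hist m j h g : cell m j h g -> Hist m g.
Proof. by case=> C [mC _]; exact: Choice_Hist mC _. Qed.

Lemma cell_eq m j h g : Hist m h -> cell m j h g -> cell m j g = cell m j h.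
Proof. by move=> /(Choice_cell j)[mC _]; exact: cellE. Qed.

Lemma sat_valuation m h : valuation (sat m h).
Proof. by constructor=> [A B|A] /=. Qed.

Lemma R_refl m : R m m.
Proof. by case: (R_preorder hM). Qed.

Lemma R_trans m1 m2 m3 : R m1 m2 -> R m2 m3 -> R m1 m3.
Proof. by case: (R_preorder hM) => _ H; exact: H. Qed.

Lemma Re_trans m1 m2 m3 : Re m1 m2 -> Re m2 m3 -> Re m1 m3.
Proof. by case: (Re_preorder hM) => _ H; exact: H. Qed.

(** Each listed agent chooses the cell of a witness of its diamond, the others that of [h];
    distinctness keeps later updates from overwriting a choice. *)
Lemma sat_independence m h (js : seq (Ag * form Ag)) :
  Hist m h -> uniq (map fst js) ->
  (forall p, List.In p js -> sat m h (Dia (Stit p.1 p.2))) ->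
  exists f : Ag -> set (set (moment M)), (forall j, Defs.Choice m j (f j)) /\
    forall p, List.In p js -> forall g, f p.1 g -> sat m g (Stit p.1 p.2).
Proof.
move=> mh; elim: js => [|[j A] js IH] /=.
  by move=> _ _; exists (fun j => cell m j h); split=> // j; case: (Choice_cell j mh).
move=> /andP[jjs ujs] jsP.
have [//|p jsp|f [fC fS]] := IH; first by apply: jsP; right.
have [g [mg gA]] : exists g, Hist m g /\ sat m g (Stit j A).
  apply: contrapT => nA; have /= := jsP (j, A) (or_introl erefl); apply=> g mg gA.
  by apply: nA; exists g.
exists (fun i => if i == j then cell m i g else f i); split=> [i|p].
  by case: eqP => // _; case: (Choice_cell i mg).
case=> [<- g' /=|jsp g']; first by rewrite eqxx => jg' u; rewrite (cell_eq mg jg'); exact: gA.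
case: eqP => [pj|_]; last exact: fS.
case/negP: jjs; rewrite -pj; apply/In_mem; apply/In_map; by exists p.
Qed.

Lemma axiom_sound A m h : is_axiom A -> Hist m h -> sat m h A.
Proof.
have vS m' h' := sat_valuation m' h'.
have Evid_Re m1 m2 t B : Re m1 m2 -> Evid m1 t B -> Evid m2 t B.
  by move=> m12; exact: (evidence_monotone hM m12).
move=> axA; case: axA m h => {A}.
- by move=> A /tautologyP tA m h _; exact: tA.
- move=> A axA m h mh.
  by apply: (@S5_sound _ (@Box Ag) _ (Hist m) (fun _ g => Hist m g) (sat m)).
- move=> j A axA m h mh.
  apply: (@S5_sound _ (Stit j) _ (Hist m) (cell m j) (sat m)) => //.
  + by move=> w u _ /cell_Hist.
  + by move=> w /(Choice_cell j)[].
  + by move=> w u v mw /(cell_eq mw) <-.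
  + by move=> w u mw /(cell_eq mw) ->; case: (Choice_cell j mw).
- by move=> j A m h mh; rewrite (val_Imp (vS _ _)) /= => HA g /cell_Hist; exact: HA.
- move=> js js0 ujs m h mh; rewrite (val_Imp (vS _ _)).
  rewrite (val_bigAnd_map (vS _ _)) => /(sat_independence mh ujs)[f [fC fS]] nS.
  have [g fg] := independence_of_agents hM fC.
  case: js js0 ujs fS nS => [//|p js] _ ujs fS nS.
  (* The head of [js] supplies a cell containing [g], so that [g] is a history through [m]. *)
  apply: (nS g); first exact: Choice_Hist (fC p.1) _ (fg p.1 I).
  by apply/(val_bigAnd_map (vS _ _)) => q jsq; exact: fS (fg q.1 I).
- move=> s t A B m h mh; rewrite !(val_Imp (vS _ _)) /= => -[sAB AB] [tA HA].
  split=> [|m' h' mm' m'h']; first exact: evidence_prod sAB tA.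
  exact: ((val_Imp (vS m' h') _ _).1 (AB _ _ mm' m'h') (HA _ _ mm' m'h')).
- move=> t A m h mh; rewrite (val_Imp (vS _ _)) /= => -[tA HA]; split.
    split=> [|m' h' mm' m'h']; first exact: evidence_bang.
    split=> [|m2 h2 m'm2]; first exact: Evid_Re tA.
    by apply: HA; exact: Re_trans m'm2.
  by move=> m' h' /(R_sub_Re hM); exact: HA.
- move=> s t A m h mh; rewrite (val_Imp (vS _ _)) (val_Or (vS _ _)) /=.
  by move=> [] [tA HA]; split=> //; apply: (evidence_sum hM); [left|right].
- move=> A axA m h mh.
  apply: (@S4_sound _ (@Know Ag) _ (fun w => Hist w.1 w.2)
    (fun w u => R w.1 u.1 /\ Hist u.1 u.2) (fun w => sat w.1 w.2) _ _ _ _ _ A (m, h))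
    => // [w B _|w u _ []//|w mw|w u v mw [wu _] [uv]].
  + by split=> [HB u [wu mu]|HB m' h' wm' m'h']; [exact: HB|exact: (HB (m', h'))].
  + by split=> //; exact: R_refl.
  + by split=> //; exact: R_trans wu uv.
- move=> A m h mh; rewrite (val_Imp (vS _ _)) /= => HA g _ m' h' mm' _ g' m'g'.
  exact: HA.
- move=> j t A m h mh; rewrite (val_Imp (vS _ _)) /= => -[tj HA nt].
  split; [|split; [|split]] => //.
  + by case.
  + by move=> g jg; split=> //; rewrite /Act_cell (cell_eq mh jg).
  (* Every history lies in its own cell, so if [Prove] held on all of them, [t] would be presented
     on all. *)
  + move=> H; apply: nt => g mg.
    by have [tg _ _] := H g mg; apply: tg; case: (Choice_cell j mg).
- by move=> j t A B m h mh; rewrite (val_Imp (vS _ _)) /= => -[[tj HA nt] HB].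
- move=> t A m h mh; rewrite (val_Imp (vS _ _)) /= => -[tm [tA HA]]; split=> //.
  move=> m' h' /(R_sub_Re hM) mm' m'h'; split; first exact: (presented_proofs_transparent hM mm').
  split=> [|m2 h2 m'm2]; first exact: Evid_Re tA.
  by apply: HA; exact: Re_trans m'm2.
- by move=> t A B m h mh; rewrite (val_Imp (vS _ _)) /= => -[[tm _] HB].
- move=> j t A m h mh; rewrite (val_Imp (vS _ _)) /= => nP HP; apply: nP.
  (* If each history of the cell has some agent proving by [t], then [t] is presented on the whole
     cell, and [j] proves by it. *)
  have nP g : cell m j h g -> exists i, sat m g (Prove i t A).
    move=> jg; apply: contrapT => H; apply: (HP g jg).
    apply/(val_bigAnd_enum _ (vS _ _)) => i iP; apply: H; by exists i.
  have [_ hh] := Choice_cell j mh.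
  have [i [_ HA nt]] := nP h hh.
  split=> // g jg; have [k [tk _ _]] := nP g jg; apply: tk.
  by case: (Choice_cell k (cell_Hist jg)).
Qed.

Lemma Prove_rule_sound A (tB : seq (poly * form Ag)) m h : tB <> [::] ->
  (forall m h, Hist m h ->
    sat m h (Imp (Know A) (bigOr [seq Neg (Proven p.1 p.2) | p <- tB]))) ->
  Hist m h ->
  sat m h (Imp (Know A)
    (bigOr [seq bigAnd [seq Neg (Prove j p.1 p.2) | j <- enum Ag] | p <- tB])).
Proof.
move=> tB0 H mh; rewrite (val_Imp (sat_valuation _ _)) => KA.
apply: contrapT; rewrite (val_bigOr_map (sat_valuation _ _)) => nP.
have {nP} P p : List.In p tB -> exists j, sat m h (Prove j p.1 p.2).
  move=> tBp; apply: contrapT => nj; apply: nP; exists p; split=> //.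
  by apply/(val_bigAnd_enum _ (sat_valuation _ _)) => j jP; apply: nj; exists j.
have Acth p : List.In p tB -> Act m h p.1.
  by move=> /P[j [tj _ _]]; apply: tj; case: (Choice_cell j mh).
have [[m' [hm' mm']]|leaf] := pselect (exists m', h m' /\ lt_mom m m').
  have m'h : Hist m' h by split=> //; case: mh.
  have Rmm' : R m m' by apply: (future_always_matters hM); case: mm'.
  have := H m' h m'h; rewrite (val_Imp (sat_valuation _ _)) (val_bigOr_map (sat_valuation _ _)).
  case=> [m2 h2 m'm2|p [tBp]]; first by apply: KA; exact: R_trans m'm2.
  have [j [_ [pE pA] _]] := P p tBp; apply; split=> [g m'g|].
    have mg : Hist m g by apply: Hist_down m'g _; case: mm'.
    apply: (expansion_of_presented_proofs hM mm' m'g).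
    (* Any history through [m'] is undivided from [h] at [m], so it presents the same proofs at [m],
       and these persist to [m']. *)
    rewrite -(@new_proofs_divide_histories _ _ hM m h); first exact: Acth.
    by exists m'.
  have /(R_sub_Re hM) Remm' := Rmm'.
  split=> [|m2 h2 m'm2]; first exact: (evidence_monotone hM Remm').
  by apply: pA; exact: Re_trans m'm2.
have [p tBp] : exists p, List.In p tB.
  by case: tB tB0 {H P Acth} => [//|p tB] _; exists p; left.
have [j [_ _ npm]] := P p tBp; apply: npm => g [gh gm].
have -> : g = h; last exact: Acth.
case: mh => hh hm.
apply: (maximal_chain_leaf mom_refl mom_trans (@no_backward_branching _ _ hM) hh gh hm gm).
move=> y hy my; apply: contrapT => ym; apply: leaf; exists y; split=> //; split=> //.
by apply: nesym.
Qed.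

Lemma soundness (CS : set (form Ag)) A m h :
  const_spec CS -> normal M CS -> provable CS A -> Hist m h -> sat m h A.
Proof.
move=> [CSform CSclosed] nCS pA; elim: pA m h => {A}.
- by move=> A axA m h; exact: axiom_sound.
- move=> A B _ AB _ PA m h mh.
  by have := AB m h mh; rewrite (val_Imp (sat_valuation _ _)); apply; exact: PA.
- by move=> A _ PA m h mh m' h' _; exact: PA.
- by move=> A tB tB0 _ IH m h; exact: Prove_rule_sound.
(* Induction on the prefix of constants: normality gives the evidence, and closure of [CS] keeps the
   formula under the outermost constant within reach. *)
- move=> A CSA; have [c [cs [B [axB AE]]]] := CSform A CSA.
  elim: cs c A CSA AE => [|d cs IH] c A CSA AE m h mh; subst A.
    by split=> [|m' h' _ m'h']; [exact: nCS|exact: (axiom_sound axB m'h')].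
  split=> [|m' h' _ m'h']; first exact: nCS.
  exact: (IH d _ (CSclosed _ _ _ CSA) erefl m' h' m'h').
Qed.

Lemma satisfiable_consistent (CS Gamma : set (form Ag)) :
  const_spec CS -> normal M CS -> satisfiable_in M Gamma -> consistent CS Gamma.
Proof.
move=> hCS nCS [m [h [mh GA]]] s /List.Forall_forall sG /soundness.
move=> /(_ m h hCS nCS mh) /(val_Imp (sat_valuation _ _)) H.
apply: (val_Bot (sat_valuation m h)); apply: H.
by apply/(val_bigAnd (sat_valuation _ _)) => A /sG; exact: GA.
Qed.

End Soundness.

(** * A model in which nothing is proven *)

Section OnePointModel.
Variables (Ag : finType) (CS : set (form Ag)).

(** Everything counts as evidence, which makes it normal for every [CS], and nothing is ever
    presented. *)
Definition one_point : jstit_structure Ag :=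
  @JstitStructure Ag unit (fun _ _ => True) (fun _ _ => [set [set setT]])
    (fun _ _ => set0) (fun _ _ => True) (fun _ _ => True) (fun _ _ => setT)
    (fun _ _ _ => True).

Lemma one_point_Hist m (h : set (moment one_point)) : Hist m h <-> h = setT.
Proof.
split=> [[[_ maxh] _]|->]; first by apply/esym/maxh => //; left.
split=> //; split=> [|h' _ Th']; first by left.
by apply/seteqP.
Qed.

Lemma one_point_model : is_jstit_model one_point.
Proof.
have lt_irr m m' : ~ lt_mom (M := one_point) m m' by case: m m' => [] [] [].
split=> //.
- by split=> // -[] [].
- move=> m j; split=> /=.
  + apply/seteqP; split=> [h [C -> ->]|h /one_point_Hist ->]; first exact/one_point_Hist.
    by exists [set setT].
  + by move=> C C' -> ->.
  + by move=> C ->; exists setT.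
- by move=> m m'; exists m.
- by left.
- by move=> m j h h' [m' [/lt_irr]].
- by move=> m f fC; exists setT => j _; rewrite (fC j).
- by move=> m m' h /lt_irr.
- by move=> m t /(_ setT) []; exact/one_point_Hist.
- by move=> m m' _ t /(_ setT) []; exact/one_point_Hist.
Qed.

Lemma unproven_mcs : const_spec CS -> exists G : mcs CS, proven G = set0.
Proof.
move=> hCS; pose X : form Ag -> Prop := sat (M := one_point) tt setT.
have cX : consistent CS X.
  apply: (satisfiable_consistent one_point_model hCS) => //.
  by exists tt, setT; split=> //; exact/one_point_Hist.
exists (Mcs cX (fun A => EM (X A))); apply/seteqP; split=> // t [A] /=.
by case=> /(_ setT) []; exact/one_point_Hist.
Qed.

End OnePointModel.

(** * The canonical tree *)

Lemma cat_eq_prefix (T : Type) (s1 s2 u v : seq T) :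
  s1 ++ u = s2 ++ v -> (exists w, s2 = s1 ++ w) \/ exists w, s1 = s2 ++ w.
Proof.
elim: s1 s2 => [|x s1 IH] [|y s2] //=; try by [left; eexists|right; eexists].
by move=> [<- /IH[[w ->]|[w ->]]]; [left|right]; exists w.
Qed.

Section CanonicalModel.
Variables (Ag : finType) (CS : set (form Ag)) (G0 : mcs CS) (succ : mcs CS -> mcs CS).
Hypothesis G0_unproven : proven G0 = set0.
Hypothesis succ_acc : forall D, acc (@Know Ag) D (succ D).
Hypothesis succ_proven : forall D, being_proved D `<=` proven (succ D).
Hypothesis succ_maximal : forall D, know_maximal (succ D).
Implicit Types (G D : mcs CS) (A B : form Ag) (j : Ag).

(* [Up G D k s] lies above [Base G], on the histories where [D] is chosen there;
   the nodes [Up G D k [::]] descend towards [Base G] as [k] grows, and the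
   nodes with [s] nonempty branch off from them. *)
Inductive node : Type :=
| Root
| Base of mcs CS
| Up of mcs CS & mcs CS & nat & seq (mcs CS).
Implicit Types (m : node) (h g : set node).

(** The index [k] is ordered in reverse along the nodes with empty list; for equal indices the lists
    are ordered by prefix. *)
Definition nle m m' : Prop :=
  match m, m' with
  | Root, _ => True
  | Base G, Base G' => G = G'
  | Base G, Up G' _ _ _ => G = G'
  | Up G D k s, Up G' D' k' s' =>
      [/\ G = G', D = D' & (s = [::] /\ k' <= k) \/ (k = k' /\ exists u, s' = s ++ u)]
  | _, _ => False
  end.

Definition nlt m m' : Prop := nle m m' /\ m <> m'.

Lemma nle_refl m : nle m m.
Proof.
case: m => //= G D k s; split=> //; right; split=> //.
by exists [::]; rewrite cats0.
Qed.

Lemma nle_trans m1 m2 m3 : nle m1 m2 -> nle m2 m3 -> nle m1 m3.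
Proof.
case: m1 => [|G1|G1 D1 k1 s1]; case: m2 => [|G2|G2 D2 k2 s2];
  case: m3 => [|G3|G3 D3 k3 s3] //=; try by move=> -> // ->.
- by move=> -> [].
- move=> [-> -> H1] [-> -> H2]; split=> //.
  case: H1 => [[-> k21]|[-> [u us2]]].
    case: H2 => [[_ k32]|[<- _]]; last by left.
    by left; split=> //; exact: leq_trans k32 k21.
  case: H2 => [[s2E k32]|[<- [u' us3]]]; last first.
    by right; split=> //; exists (u ++ u'); rewrite us3 us2 catA.
  by left; split=> //; move: us2; rewrite s2E; case: s1.
Qed.

Lemma nle_anti m1 m2 : nle m1 m2 -> nle m2 m1 -> m1 = m2.
Proof.
case: m1 => [|G1|G1 D1 k1 s1]; case: m2 => [|G2|G2 D2 k2 s2] //=.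
  by move=> ->.
move=> [-> -> H1] [_ _ H2]; congr Up.
  case: H1 H2 => [[_ k21]|[//]] [[_ k12]|[//]].
  by apply/eqP; rewrite eqn_leq k12 k21.
case: H1 H2 => [[s1E _]|[_ [u su]]] [[s2E _]|[_ [v sv]]].
- by rewrite s1E s2E.
- by move: sv; rewrite s1E; case: (s2).
- by move: su; rewrite s2E; case: (s1).
- move: (congr1 size su); rewrite sv !size_cat -addnA => /eqP.
  rewrite -{1}[size s2]addn0 eqn_add2l eq_sym addn_eq0 => /andP[/nilP -> _].
  exact: cats0.
Qed.

Lemma nle_nbb m m1 m2 : nle m1 m -> nle m2 m -> nle m1 m2 \/ nle m2 m1.
Proof.
case: m1 => [|G1|G1 D1 k1 s1]; case: m2 => [|G2|G2 D2 k2 s2];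
  case: m => [|G|G D k s] //=; try by [left|right].
- by move=> -> ->; left.
- by move=> -> ->; left.
- by move=> -> [->]; left.
- by move=> [-> _ _] ->; right.
move=> [-> -> H1] [-> -> H2].
case: H1 => [[-> k1k]|[k1k [u su]]]; case: H2 => [[-> k2k]|[k2k [v sv]]].
- by case/orP: (leq_total k1 k2) => k12; [right|left]; split=> //; left.
- by left; split=> //; left; rewrite k2k.
- by right; split=> //; left; rewrite k1k.
- subst k1 k2 s; have [[w ->]|[w ->]] := cat_eq_prefix sv.
    by left; split=> //; right; split=> //; exists w.
  by right; split=> //; right; split=> //; exists w.
Qed.

(** Nodes carry arbitrary maximal consistent sets; one outside the class of [G] is read as [G],
    which spares a side condition in [node]. *)
Definition project G D : mcs CS := if pselect (eqv (@Box Ag) G D) then D else G.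

Lemma projectP G D : eqv (@Box Ag) G (project G D).
Proof. by rewrite /project; case: pselect. Qed.

Lemma project_id G D : eqv (@Box Ag) G D -> project G D = D.
Proof. by rewrite /project; case: pselect. Qed.

Definition center m : mcs CS :=
  match m with
  | Root => G0
  | Base G => G
  | Up G D _ _ => succ (project G D)
  end.

(* The member of the class of [center m] attached at [m] to the histories that
   pass through [m'], for [m] strictly below [m']. At the root it only records
   which [Base G] the history goes through. *)
Definition toward m m' : mcs CS :=
  match m, m' with
  | Root, Base G => G
  | Root, Up G _ _ _ => G
  | Base G, Up _ D _ _ => project G D
  | Up G D k s, Up _ _ k' s' =>
      let C := succ (project G D) in
      if k' == k then project C (nth C s' (size s)) else C
  | _, _ => G0
  end.

(** Once above [m] with the same index, the list entry at position [size s] is fixed; with a smaller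
    index, the index stays smaller further up. *)
Lemma toward_mono m m' m'' :
  nlt m m' -> nle m' m'' -> toward m m' = toward m m''.
Proof.
case: m => [|G|G D k s]; case: m' => [|G'|G' D' k' s'];
  case: m'' => [|G''|G'' D'' k'' s''] //= [] //=.
- by move=> _ _ [->].
- by move=> ->.
- by move=> _ _ [_ ->].
- move=> [<- <- H] neq [_ _ H'].
  have [k'k|k'k] := eqVneq k' k; last first.
    have {H} k'lt : k' < k.
      by case: H => [[_ H]|[kk' _]]; [rewrite ltn_neqAle k'k|rewrite kk' eqxx in k'k].
    have k''k' : k'' <= k' by case: H' => [[]|[->]].
    by rewrite ltn_eqF // (leq_ltn_trans k''k').
  subst k'; have {H} [x [u su]] : exists x u, s' = s ++ x :: u.
    have [u su] : exists u, s' = s ++ u.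
      by case: H => [[-> _]|[_ //]]; exists s'.
    case: u su neq => [|x u] su neq; last by exists x, u.
    by case: neq; rewrite su cats0.
  case: H' => [[s'E]|[<- [v sv]]]; first by move: su; rewrite s'E; case: (s).
  by rewrite eqxx sv su -catA !nth_cat ltnn subnn.
Qed.

Lemma toward_class m m' :
  m <> Root -> nlt m m' -> eqv (@Box Ag) (center m) (toward m m').
Proof.
case: m => [//|G|G D k s]; case: m' => [|G'|G' D' k' s'] //= _ [] //=.
- by move=> ->.
- by move=> _ _; exact: projectP.
- by move=> _ _; case: eqP => _; [exact: projectP|exact: eqv_refl].
Qed.

(** Moving up either stays within one [Box]-class, which shares its knowledge, or passes through
    [succ]. *)
Lemma toward_acc m m' : nlt m m' -> acc (@Know Ag) (toward m m') (center m').
Proof.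
have proj G D : acc (@Know Ag) G (succ (project G D)).
  apply: acc_Know_trans _ (@succ_acc _).
  by apply: eqv_Box_acc_Know; exact: projectP.
case: m => [|G|G D k s]; case: m' => [|G'|G' D' k' s'] //= [] //=.
- by move=> _ _; exact: acc_Know_refl.
- by move=> ->.
- by move=> <- _; exact: succ_acc.
- move=> [<- <- _] _; case: eqP => _; last exact: acc_Know_refl.
  by apply: eqv_Box_acc_Know; apply: eqv_sym; exact: projectP.
Qed.

Lemma nle_acc m m' : m <> Root -> nle m m' -> acc (@Know Ag) (center m) (center m').
Proof.
move=> m0 mm'; have [->|m'm] := pselect (m = m'); first exact: acc_Know_refl.
have lt : nlt m m' by [].
apply: acc_Know_trans _ (toward_acc lt).
by apply: eqv_Box_acc_Know; exact: toward_class.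
Qed.

(** Above [Base G] take a tree labelled [D] (index 0 will do); above an [Up] node append [D] to its
    list. *)
Lemma toward_surj m D : m <> Root -> eqv (@Box Ag) (center m) D ->
  exists m', nlt m m' /\ toward m m' = D.
Proof.
case: m => [//|G|G E k s] /= _ GD.
  by exists (Up G D 0 [::]); split=> //=; exact: project_id.
exists (Up G E k (rcons s D)); split; first split=> /=.
- by split=> //; right; split=> //; exists [:: D]; rewrite cats1.
- by move=> [] /(congr1 size); rewrite size_rcons => /n_Sn.
- by rewrite /= eqxx nth_rcons ltnn eqxx; exact: project_id.
Qed.

Lemma nlt_above m : exists m', nlt m m'.
Proof.
have [->|m0] := pselect (m = Root); first by exists (Base G0).
by have [m' [mm' _]] := toward_surj m0 (@eqv_refl _ _ _ (center m)); exists m'.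
Qed.

(** Proofs in progress are left out at [Root]: they would have to persist to [Base G] on every
    history, while the members of the class of [G] may differ on them. *)
Definition shown m D : set poly :=
  proven D `|` [set t | m <> Root /\ being_proved D t].

(** From [Base G] upwards [succ] turns proofs in progress into [Proven] ones; from an [Up] node
    there are none, its class being knowledge-maximal. *)
Lemma shown_toward m m' : nlt m m' -> shown m (toward m m') `<=` proven (center m').
Proof.
move=> mm' t [Dt|[m0 Dt]]; first exact: acc_proven (toward_acc mm') _ Dt.
have lt := mm'; case: m m0 mm' lt Dt => [//|G|G D k s] _.
  case: m' => [|G'|G' D' k' s'] [] //=; first by move=> ->.
  by move=> <- _ _; exact: succ_proven.
move=> _ lt; have m0 : Up G D k s <> Root by [].
have := know_maximal_eqv (toward_class m0 lt) (@succ_maximal _).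
by move=> /know_maximal_being_proved ->.
Qed.

(** * Histories of the canonical tree, their labels, and the canonical structure *)

Definition nHist m h : Prop := maximal_chain nle h /\ h m.

Lemma nHist_exists m m' : nle m m' -> exists h, nHist m h /\ h m'.
Proof.
move=> mm'; have [|h [hh mh]] := @maximal_chain_exists _ nle [set m; m'].
  by move=> x y [->|->] [->|->]; auto using nle_refl.
by exists h; split; [split=> //|]; apply: mh; [left|right].
Qed.

Lemma nHist_down m m' h : nHist m h -> nle m' m -> nHist m' h.
Proof.
move=> [hh hm] m'm; split=> //.
exact: maximal_chain_down nle_refl nle_trans nle_nbb _ _ _ hh hm m'm.
Qed.

(** If [m] were the last moment of [h], any node above it would be comparable with all of [h] and so
    belong to it. *)
Lemma nHist_above m h : nHist m h -> exists m', h m' /\ nlt m m'.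
Proof.
move=> [hh hm]; apply: contrapT => noabove.
have [m' mm'] := nlt_above m; apply: (noabove); exists m'; split=> //.
have [m_le _] := mm'.
apply: (maximal_chain_in nle_refl hh) => y hy; right.
have [my|ym] := maximal_chain_total hh hm hy; last exact: nle_trans ym m_le.
have [<- //|nmy] := pselect (m = y).
by case: noabove; exists y.
Qed.

(** The existential avoids choosing a later moment of [h]; by [toward_unique] all choices agree. *)
Definition label m h : set (form Ag) :=
  [set A | exists m', [/\ h m', nlt m m' & toward m m' A]].

Definition nact m h : set poly :=
  [set t | exists m', [/\ h m', nlt m m' & shown m (toward m m') t]].

Lemma toward_unique m h m1 m2 : nHist m h -> h m1 -> nlt m m1 ->
  h m2 -> nlt m m2 -> toward m m1 = toward m m2.
Proof.
move=> [hh _] hm1 mm1 hm2 mm2.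
have [m12|m21] := maximal_chain_total hh hm1 hm2; first exact: toward_mono.
by apply/esym; exact: toward_mono.
Qed.

Lemma labelE m h m' : nHist m h -> h m' -> nlt m m' ->
  label m h = theory (toward m m').
Proof.
move=> mh hm' mm'; apply/seteqP; split=> [A [m2 [hm2 mm2]]|A ?]; last by exists m'.
by rewrite (toward_unique mh hm2 mm2 hm' mm').
Qed.

Lemma nactE m h m' : nHist m h -> h m' -> nlt m m' ->
  nact m h = shown m (toward m m').
Proof.
move=> mh hm' mm'; apply/seteqP; split=> [A [m2 [hm2 mm2]]|A ?]; last by exists m'.
by rewrite (toward_unique mh hm2 mm2 hm' mm').
Qed.

Lemma label_class m h : m <> Root -> nHist m h ->
  exists D, [/\ label m h = theory D, nact m h = proven D `|` being_proved D
    & eqv (@Box Ag) (center m) D].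
Proof.
move=> m0 mh; have [m' [hm' mm']] := nHist_above mh.
exists (toward m m'); split; [exact: labelE| |exact: toward_class].
by rewrite (nactE mh hm' mm') /shown; congr setU; apply/seteqP; split=> t // [].
Qed.

Lemma label_surj m D : m <> Root -> eqv (@Box Ag) (center m) D ->
  exists h, [/\ nHist m h, label m h = theory D & nact m h = proven D `|` being_proved D].
Proof.
move=> m0 GD; have [m' [mm' mD]] := toward_surj m0 GD.
have [h [mh hm']] : exists h, nHist m h /\ h m'.
  by apply: nHist_exists; case: mm'.
exists h; split=> //; first by rewrite (labelE mh hm' mm') mD.
rewrite (nactE mh hm' mm') mD /shown; congr setU.
by apply/seteqP; split=> t // [].
Qed.

(** At [Root] each agent has one vacuous choice; elsewhere cells are the [Stit j] classes of
    labels. *)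
Definition ncell m j h : set (set node) :=
  [set g | nHist m g /\
    (m <> Root -> forall A, label m h (Stit j A) <-> label m g (Stit j A))].

(** [Root] sees everything and is seen only by itself, so the truth lemma can leave it out. *)
Definition nR m m' : Prop :=
  m = Root \/ m' <> Root /\ acc (@Know Ag) (center m) (center m').

(** Evidence at [Root] must persist to all nodes, hence the restriction to provable justifications
    there. *)
Definition nevid m (t : poly) : set (form Ag) :=
  match m with
  | Root => [set A | provable CS (Just t A)]
  | _ => [set A | center m (Just t A)]
  end.

Definition canonical : jstit_structure Ag :=
  @JstitStructure Ag node nle
    (fun m j => [set C | exists2 h, nHist m h & C = ncell m j h])
    nact nR nR nevid (fun p m h => label m h (Var p)).

Lemma ncell_refl m j h : nHist m h -> ncell m j h h.
Proof. by []. Qed.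

Lemma ncell_eq m j h g : ncell m j h g -> ncell m j g = ncell m j h.
Proof.
move=> [_ hg]; apply/seteqP; split=> f [mf H]; split=> // m0 A.
  exact: iff_trans (hg m0 A) (H m0 A).
exact: iff_trans (iff_sym (hg m0 A)) (H m0 A).
Qed.

Lemma canonical_cell m j h :
  nHist m h -> cell (M := canonical) m j h = ncell m j h.
Proof.
move=> mh; apply/seteqP; split=> [g [_ [[f mf ->] /ncell_eq fh]]|g hg].
  by rewrite fh.
by exists (ncell m j h) => //; split; [exists h|exact: ncell_refl].
Qed.

Lemma ncellP m j h g D E : m <> Root -> nHist m g ->
  label m h = theory D -> label m g = theory E ->
  ncell m j h g <-> eqv (Stit j) D E.
Proof.
move=> m0 mg hD gE; split=> [[_ /(_ m0)]|DE]; first by rewrite hD gE.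
by split=> // _; rewrite hD gE.
Qed.

(** At [Root], a history through [Base G0] presents nothing; elsewhere [class_without_proof] yields
    a history that omits any [t] not proven. *)
Lemma canonical_Act_moment m :
  Act_moment (M := canonical) m = [set t | m <> Root /\ proven (center m) t].
Proof.
apply/seteqP; split=> [t mt|t [m0 mt] h mh].
  have m0 : m <> Root.
    move=> mE; subst m; have [h [Rh hG0]] := @nHist_exists Root (Base G0) I.
    have /= := mt h Rh; rewrite (nactE Rh hG0) //.
    by case=> [|[]] //=; rewrite G0_unproven.
  split=> //; apply: contrapT => /class_without_proof[D [mD nD]].
  have [h [mh _ hD]] := label_surj m0 mD.
  by apply: nD; rewrite -hD; exact: mt.
have [D [_ /= -> mD]] := label_class m0 mh; left.
exact: acc_proven (eqv_Box_acc_Know mD) _ mt.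
Qed.

Lemma nevid_MP m s t A B : nevid m s (Imp A B) -> nevid m t A -> nevid m (PProd s t) B.
Proof.
case: m => [|G|G D k r] /=.
- move=> sAB; apply: Pr_MP; apply: Pr_MP sAB; apply: Pr_axiom; exact: A4.
- by move=> /(mcs_axiom (A4 _ t _ _)) /(val_Imp (mcs_valuation _)).
- by move=> /(mcs_axiom (A4 _ t _ _)) /(val_Imp (mcs_valuation _)).
Qed.

Lemma nevid_imp m s t A B :
  provable CS (Imp (Just s A) (Just t B)) -> nevid m s A -> nevid m t B.
Proof.
by case: m => [|G|G D k r] /= pst; [exact: Pr_MP|exact: mcs_Imp..].
Qed.

Lemma canonical_model : is_jstit_model canonical.
Proof.
have order : Relation_Definitions.order _ nle.
  split; [exact: nle_refl|exact: nle_trans|exact: nle_anti].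
have pre : Relation_Definitions.preorder _ nR.
  split=> [m|m1 m2 m3 [->|[m2R m12]]]; last first.
  - by case=> [//|[m3R m23]]; right; split=> //; exact: acc_Know_trans m12 m23.
  - by left.
  - have [->|mR] := pselect (m = Root); first by left.
    by right; split=> //; exact: acc_Know_refl.
split=> //.
- move=> m j; split=> /=.
  + apply/seteqP; split=> [h [_ [g mg ->] [] //]|h mh].
    by exists (ncell m j h); [exists h|exact: ncell_refl].
  + move=> _ _ [h mh ->] [g mg ->] [f [/ncell_eq hf /ncell_eq gf]].
    by rewrite -hf gf.
  + by move=> _ [h mh ->]; exists h; exact: ncell_refl.
- by move=> m m'; exists Root.
- exact: nle_nbb.
- move=> m j h h' [m' [mm' [m'h m'h']]].
  have m_le : nle m m' by case: mm'.
  have mh := nHist_down m'h m_le; have mh' := nHist_down m'h' m_le.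
  have [[_ hm'] [_ h'm']] := (m'h, m'h').
  rewrite !canonical_cell // /ncell.
  by rewrite (labelE mh hm' mm') (labelE mh' h'm' mm').
- move=> m f fC; have [mR|m0] := pselect (m = Root).
    have [h [mh _]] := nHist_exists (nle_refl m); exists h => j _.
    by have [g _ ->] := fC j; split.
  (* Each chosen cell is given by a label [D]; the canonical independence lemma finds one set in all
     these classes, and some history carries it. *)
  have fD j : exists D, eqv (@Box Ag) (center m) D /\
      forall g E, nHist m g -> label m g = theory E -> eqv (Stit j) D E -> f j g.
    have [h mh ->] := fC j; have [D [hD _ mD]] := label_class m0 mh.
    by exists D; split=> // g E mg gE DE; apply/(ncellP _ m0 mg hD gE).
  have [d dP] := choice fD.
  have [E [mE dE]] := mcs_independence (fun j => (dP j).1).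
  have [h [mh hE _]] := label_surj m0 mE.
  by exists h => j _; exact: (dP j).2 mh hE (dE j).
- move=> m m' t [->|[m'R mm']] A.
    by case: m' => [|G|G D k s] /=; [|exact: mcs_provable..].
  case: m m' m'R mm' => [|G|G D k s] [|G'|G' D' k' s'] //= _ mm'.
  + exact: mcs_provable.
  + exact: mcs_provable.
  + exact: acc_Just.
  + exact: acc_Just.
  + exact: acc_Just.
  + exact: acc_Just.
- exact: nevid_MP.
- move=> m s t A [|]; apply: nevid_imp; apply: provable_conseq (Pr_axiom CS (A6 s t A));
  move=> P vP /(val_Imp vP) H; apply/(val_Imp vP) => PA; apply: H;
  by apply/(val_Or vP); auto.
- move=> m t A; apply: nevid_imp; apply: provable_conseq (Pr_axiom CS (A5 t A)).
  by move=> P vP; rewrite !(val_Imp vP) (val_And vP) => H /H[].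
- move=> m m' h m'm mh t /=; have [_ hm] := mh.
  have m_le : nle m' m by case: m'm.
  rewrite (nactE (nHist_down mh m_le) hm m'm) => /(shown_toward m'm) mt.
  have mR : m <> Root by move=> mE; subst m; case: m' m'm m_le => [[_ []]| |].
  have [D [_ /= -> mD]] := label_class mR mh; left.
  exact: acc_proven (eqv_Box_acc_Know mD) _ mt.
- move=> m t; rewrite canonical_Act_moment => -[m0 mt].
  (* The earlier moment is [Root] for a [Base] node; for an [Up] node it is [Up G D k.+1 [::]],
     whose larger index makes [toward] return the common center. *)
  have [m' [m'm mt']] : exists m', nlt m' m /\ shown m' (toward m' m) t.
    case: m m0 mt => [//|G|G D k s] _ mt; first by exists Root; split=> //; left.
    exists (Up G D k.+1 [::]); split; last by rewrite /= ltn_eqF //; left.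
    split; first by split=> //; left.
    by case=> /esym /n_Sn.
  have m'_le : nle m' m by case: m'm.
  have [h [mh _]] := nHist_exists (nle_refl m); exists m', h; split=> //=.
  by rewrite (nactE (nHist_down mh m'_le) _ m'm) //; case: mh.
- move=> m h h' [m' [mm' [m'h m'h']]] /=.
  have m_le : nle m m' by case: mm'.
  have mh := nHist_down m'h m_le; have mh' := nHist_down m'h' m_le.
  have [[_ hm'] [_ h'm']] := (m'h, m'h').
  by rewrite (nactE mh hm' mm') (nactE mh' h'm' mm').
- move=> m m' /= mm'; have [->|m0] := pselect (m = Root); first by left.
  right; split; last exact: nle_acc.
  by move=> m'E; subst m'; case: m m0 mm'.
- move=> m m' mm' t; rewrite !canonical_Act_moment => -[m0 mt].
  case: mm' => [//|[m'R mm']]; split=> //; exact: acc_proven mm' _ mt.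
Qed.

Lemma canonical_normal : normal canonical CS.
Proof.
move=> c m A /= cA; have pcA : provable CS (Just (PConst c) A) by exact: Pr_CS.
by case: m => [|G|G D k s] //=; exact: mcs_provable.
Qed.

(** The induction never meets [Root], since no other node sees it through [nR]. *)
Lemma truth A m h : m <> Root -> nHist m h ->
  sat (M := canonical) m h A <-> label m h A.
Proof.
(* Shared by the cases of [Just], [Prove] and [Proven]. *)
have JustP t B m' D : (forall m h, m <> Root -> nHist m h ->
      sat (M := canonical) m h B <-> label m h B) ->
    m' <> Root -> eqv (@Box Ag) (center m') D ->
    (nevid m' t B /\ forall m2 h2, nR m' m2 -> nHist m2 h2 ->
      sat (M := canonical) m2 h2 B) <-> D (Just t B).
  move=> IH m0 mD.
  have -> : nevid m' t B = center m' (Just t B) by case: (m') m0.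
  split=> [[mB _]|DB]; first exact: acc_Just (eqv_Box_acc_Know mD) mB.
  have mB := acc_Just (eqv_Box_acc_Know (eqv_sym mD)) DB.
  split=> // m2 h2 [//|[m2R m'm2]] m2h2; apply/(IH _ _ m2R m2h2).
  have [E [-> _ m2E]] := label_class m2R m2h2.
  have [_] := Just_PBang (acc_Just m'm2 mB).
  by move=> /(acc_Know (eqv_Box_acc_Know m2E)) /Know_elim.
elim: A m h => [p|A IHA B IHB|A IHA|j A IHA|A IHA|t A IHA|A IHA|j t A IHA|t A IHA]
    m h m0 mh; have [D [hD hact mD]] := label_class m0 mh; have vD := mcs_valuation D.
- by [].
- by rewrite /= IHA // IHB // hD (val_And vD).
- by rewrite /= IHA // hD (val_Neg vD).
- rewrite hD StitP /= canonical_cell //; split=> [HA E DE|HA g].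
    have [g [mg gE _]] := label_surj m0 (eqv_trans mD (eqv_Stit_Box DE)).
    rewrite -gE; apply/(IHA _ _ m0 mg); apply: HA.
    exact/(ncellP _ m0 mg hD gE).
  move=> hg; have [mg _] := hg; have [E [gE _ mE]] := label_class m0 mg.
  apply/(IHA _ _ m0 mg); rewrite gE; apply: HA.
  exact/(ncellP _ m0 mg hD gE).
- rewrite hD BoxP /=; split=> [HA E DE|HA g mg].
    have [g [mg gE _]] := label_surj m0 (eqv_trans mD DE).
    by rewrite -gE; apply/(IHA _ _ m0 mg); exact: HA.
  have [E [gE _ mE]] := label_class m0 mg.
  apply/(IHA _ _ m0 mg); rewrite gE; apply: HA.
  exact: eqv_trans (eqv_sym mD) mE.
- by rewrite hD -(JustP t A m D IHA m0 mD).
- rewrite hD; split=> [HA|DA m' h' [//|[m'R mm']] m'h'].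
    (* An arbitrary epistemic successor [E] is realised at the node [Base E]. *)
    apply/KnowP => E DE; have ER : Base E <> Root by [].
    have [g [mg gE _]] := label_surj ER (@eqv_refl _ _ _ E).
    rewrite -gE; apply/(IHA _ _ ER mg); apply: HA => //; right; split=> //.
    exact: acc_Know_trans (eqv_Box_acc_Know mD) DE.
  apply/(IHA _ _ m'R m'h'); have [E [-> _ m'E]] := label_class m'R m'h'.
  apply: Know_elim; apply: (acc_Know (eqv_Box_acc_Know m'E)).
  by apply: (acc_Know mm'); apply: acc_Know DA; exact: eqv_Box_acc_Know (eqv_sym mD).
- rewrite hD /= (propext (JustP t A m D IHA m0 mD)) canonical_Act_moment.
  rewrite /Act_cell canonical_cell //; split=> [[jt DA nmt]|].
    apply: contrapT => nP.
    have nDt : ~ proven D t.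
      move=> Dt; apply: nmt; split=> //.
      exact: acc_proven (eqv_Box_acc_Know (eqv_sym mD)) _ Dt.
    (* Otherwise some history in the cell of [j] would not present [t], against [jt]. *)
    have [E [DE nE]] := cell_without_proof DA nDt nP.
    have [g [mg gE gact]] := label_surj m0 (eqv_trans mD (eqv_Stit_Box DE)).
    apply: nE; rewrite -gact; apply: jt.
    exact/(ncellP _ m0 mg hD gE).
  move=> /ProveE[nDt /StitP DP _ DA]; split=> //.
    move=> g hg; have [mg _] := hg; have [E [gE /= -> mE]] := label_class m0 mg.
    by right; exists j, A; apply: DP; exact/(ncellP _ m0 mg hD gE).
  move=> [_ [B mB]]; apply: nDt; apply: Proven_transfer DA.
  exact: acc_Proven (eqv_Box_acc_Know mD) mB.
- rewrite hD /= (propext (JustP t A m D IHA m0 mD)) canonical_Act_moment.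
  split=> [[[_ [B mB]] DA]|DA].
    by apply: Proven_transfer DA; exact: acc_Proven (eqv_Box_acc_Know mD) mB.
  split; last by have [] := Proven_Just DA.
  split=> //; exists A; exact: acc_Proven (eqv_Box_acc_Know (eqv_sym mD)) DA.
Qed.

Lemma canonical_satisfiable G (Gamma : set (form Ag)) :
  Gamma `<=` theory G -> satisfiable_in canonical Gamma.
Proof.
move=> GammaG; have GR : Base G <> Root by [].
have [h [Gh hG _]] := label_surj GR (@eqv_refl _ _ _ G).
exists (Base G), h; split=> // A /GammaG GA.
by apply/(truth _ GR Gh); rewrite hG.
Qed.

End CanonicalModel.

(** * Completeness and the equivalences *)

Lemma completeness (Ag : finType) (CS Gamma : set (form Ag)) :
  const_spec CS -> consistent CS Gamma ->
  exists M : jstit_structure Ag, is_jstit_model M /\ unirelational M /\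
    normal M CS /\ satisfiable_in M Gamma.
Proof.
move=> /unproven_mcs[G0 G0P] /lindenbaum[G GammaG].
have [succ succP] := choice (@successor_exists Ag CS).
(* Unirelationality is immediate: both accessibility relations are [nR]. *)
exists (canonical G0 succ); split; [|split; [by []|split]].
- by apply: canonical_model => // D; have [] := succP D.
- exact: canonical_normal.
- exact: canonical_satisfiable GammaG.
Qed.

Theorem theorem2 (Ag : finType) (CS Gamma : set (form Ag))
    (hCS : const_spec CS) :
  (consistent CS Gamma <->
     exists M : jstit_structure Ag,
       is_jstit_model M /\ normal M CS /\ satisfiable_in M Gamma) /\
  ((exists M : jstit_structure Ag,
       is_jstit_model M /\ normal M CS /\ satisfiable_in M Gamma) <->
   (exists M : jstit_structure Ag,
       is_jstit_model M /\ unirelational M /\ normal M CS /\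
       satisfiable_in M Gamma)).
Proof.
have sound : (exists M : jstit_structure Ag,
    is_jstit_model M /\ normal M CS /\ satisfiable_in M Gamma) -> consistent CS Gamma.
  by move=> [M [hM [nM satM]]]; exact: satisfiable_consistent hM _ _ hCS nM satM.
have forget : (exists M : jstit_structure Ag,
    is_jstit_model M /\ unirelational M /\ normal M CS /\ satisfiable_in M Gamma) ->
  exists M : jstit_structure Ag,
    is_jstit_model M /\ normal M CS /\ satisfiable_in M Gamma.
  by move=> [M [hM [_ nsM]]]; exists M.
split; split=> //.
- by move=> /(completeness hCS) /forget.
- by move=> /sound; exact: completeness.
Qed.
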